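(* Let $R$ be a Gorenstein quasi-fiber product ring with respect to the regular sequence $\underline x=x_1,\ldots,x_n$. Let $M$ be a finitely generated $R$-module. If for some even number $t>n$ one has $\operatorname{Ext}^i_R(M,M)=0$ whenever $t\le i\le t+n$, then $\operatorname{pd}_R M<\infty$.
   Context: All local rings are commutative and Noetherian, and all modules are finitely generated; $\operatorname{pd}$ denotes projective dimension. A local ring $(R,\mathfrak m,k)$ is a fiber product ring if $R\cong S\times_k T=\{(s,t)\in S\times T : \pi_S(s)=\pi_T(t)\}$, where $S,T$ are local rings with the same residue field $k$, neither of them equal to $k$, and $\pi_S,\pi_T$ are the reductions modulo the maximal ideals. Equivalently, $\mathfrak m=I\oplus J$ for nonzero ideals $I,J$ of $R$. A local ring $R$ is a quasi-fiber product ring with respect to $\underline x=x_1,\dots,x_n$ ($n\ge 0$) if $\underline x$ is an $R$-regular sequence such that $R/(\underline x)$ is a fiber product ring. *)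

(* Defs.v *)
From HB Require Import structures.
From mathcomp Require Import all_boot all_order all_algebra.
From mathcomp Require Import ring_quotient boolp.

Set Implicit Arguments.
Unset Strict Implicit.
Unset Printing Implicit Defensive.

Import GRing.Theory.
Local Open Scope ring_scope.

(* In MathComp, [idealr_closed I] says that I is a *proper* ideal of R. *)

Definition ideal_gen (R : comNzRingType) (s : seq R) : {pred R} :=
  fun a => `[< exists c : 'I_(size s) -> R, a = \sum_i c i * s`_i >].

(* The unit ideal, which is not quantified over here, is generated by 1. *)
Definition noetherian (R : comNzRingType) : Prop :=
  forall I : {pred R}, idealr_closed I -> exists s : seq R, I =i ideal_gen s.

Definition maximal_ideal (R : comNzRingType) (m : {pred R}) : Prop :=
  idealr_closed m /\
  forall J : {pred R}, idealr_closed J -> {subset m <= J} -> J =i m.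

Definition local_ring (R : comNzRingType) : Prop :=
  noetherian R /\
  exists2 m : {pred R},
    maximal_ideal m & forall m' : {pred R}, maximal_ideal m' -> m' =i m.

Section FiberProduct.
Variables (S T : comNzRingType) (k : fieldType).
Variables (piS : {rmorphism S -> k}) (piT : {rmorphism T -> k}).

Definition fiber_pred : {pred S * T} := fun u => piS u.1 == piT u.2.

Lemma fiber_pred_subring : subring_closed fiber_pred.
Proof.
split=> [|u v|u v]; rewrite !unfold_in ?rmorph1 //.
- by move=> /eqP eu /eqP ev; rewrite !rmorphB eu ev.
- by move=> /eqP eu /eqP ev; rewrite !rmorphM eu ev.
Qed.

HB.instance Definition _ :=
  GRing.isSubringClosed.Build (S * T)%type fiber_pred fiber_pred_subring.

Record fiber_product := FiberProduct
  { fiber_val :> S * T; _ : fiber_val \in fiber_pred }.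

HB.instance Definition _ := [isSub for fiber_val].
HB.instance Definition _ := [Choice of fiber_product by <:].
HB.instance Definition _ := [SubChoice_isSubComNzRing of fiber_product by <:].

End FiberProduct.

(* A surjection from a local ring onto a field is, up to isomorphism, the
   reduction modulo the maximal ideal; it is injective exactly when the ring
   is equal to its residue field. *)
Definition fiber_product_ring (R : comNzRingType) : Prop :=
  local_ring R /\
  exists (S T : comNzRingType) (k : fieldType)
         (piS : {rmorphism S -> k}) (piT : {rmorphism T -> k}),
  [/\ local_ring S /\ local_ring T,
      (forall c, exists s, piS s = c) /\ (forall c, exists u, piT u = c),
      ~ injective piS /\ ~ injective piT
    & exists f : {rmorphism R -> fiber_product piS piT}, bijective f].

(* [x_i] is a nonzerodivisor on [R/(x_0,...,x_(i-1))], and [R/(x)] is nonzero. *)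
Definition regular_sequence (R : comNzRingType) (x : seq R) : Prop :=
  (forall i, (i < size x)%N -> forall a,
     x`_i * a \in ideal_gen (take i x) -> a \in ideal_gen (take i x)) /\
  1 \notin ideal_gen x.

Definition quasi_fiber_product_ring (R : comNzRingType) (x : seq R) : Prop :=
  [/\ local_ring R, regular_sequence x
    & exists2 I : idealr R, I =i ideal_gen x
                          & fiber_product_ring {ideal_quot I}].

Section Modules.
Variable R : comNzRingType.

Definition finitely_generated (M : lmodType R) : Prop :=
  exists s : seq M, forall y : M,
    exists c : 'I_(size s) -> R, y = \sum_i c i *: s`_i.

Definition projective_module (P : lmodType R) : Prop :=
  forall (A B : lmodType R) (f : {linear A -> B}) (g : {linear P -> B}),
    (forall b, exists a, f a = b) ->
  exists h : {linear P -> A}, forall p, f (h p) = g p.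

Definition injective_module (E : lmodType R) : Prop :=
  forall (A B : lmodType R) (f : {linear A -> B}) (g : {linear A -> E}),
    injective f ->
  exists h : {linear B -> E}, forall a, h (f a) = g a.

Record projective_resolution (M : lmodType R) := ProjectiveResolution {
  pr_obj :> nat -> lmodType R;
  pr_d : forall i, {linear pr_obj i.+1 -> pr_obj i};
  pr_aug : {linear pr_obj 0%N -> M};
  pr_projective : forall i, projective_module (pr_obj i);
  pr_aug_surj : forall y, exists z, pr_aug z = y;
  pr_exact0 : forall z, pr_aug z = 0 <-> exists w, pr_d 0%N w = z;
  pr_exactS : forall i z, pr_d i z = 0 <-> exists w, pr_d i.+1 w = z
}.

Record injective_resolution (M : lmodType R) := InjectiveResolution {
  ir_obj :> nat -> lmodType R;
  ir_d : forall i, {linear ir_obj i -> ir_obj i.+1};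
  ir_aug : {linear M -> ir_obj 0%N};
  ir_injective : forall i, injective_module (ir_obj i);
  ir_aug_inj : injective ir_aug;
  ir_exact0 : forall z, ir_d 0%N z = 0 <-> exists w, ir_aug w = z;
  ir_exactS : forall i z, ir_d i.+1 z = 0 <-> exists w, ir_d i w = z
}.

Definition projdim_le (M : lmodType R) (d : nat) : Prop :=
  exists P : projective_resolution M,
    forall i, (d < i)%N -> forall z : P i, z = 0.

Definition finite_projdim (M : lmodType R) : Prop :=
  exists d : nat, projdim_le M d.

Definition injdim_le (M : lmodType R) (d : nat) : Prop :=
  exists E : injective_resolution M,
    forall i, (d < i)%N -> forall z : E i, z = 0.

Definition finite_injdim (M : lmodType R) : Prop :=
  exists d : nat, injdim_le M d.

Section Ext.
Variables (M N : lmodType R) (P : projective_resolution M).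

Definition Hom_cocycle (i : nat) (f : {linear P i -> N}) : Prop :=
  forall z : P i.+1, f (pr_d P i z) = 0.

Definition Hom_coboundary (i : nat) : {linear P i -> N} -> Prop :=
  match i with
  | 0 => fun f => forall z, f z = 0
  | j.+1 => fun f => exists g : {linear P j -> N}, forall z, f z = g (pr_d P j z)
  end.

End Ext.

(* Ext^i(M, N) is the i-th cohomology of Hom(P, N), for any projective
   resolution P of M; its vanishing does not depend on the choice of P. *)
Definition Ext_eq0 (i : nat) (M N : lmodType R) : Prop :=
  forall (P : projective_resolution M) (f : {linear P i -> N}),
    Hom_cocycle f -> Hom_coboundary f.

End Modules.

Definition gorenstein (R : comNzRingType) : Prop :=
  local_ring R /\ finite_injdim (R^o : lmodType R).

(* Main.v *)
From HB Require Import structures.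
Require Import Defs.
From mathcomp Require Import all_boot all_order all_algebra.
From mathcomp Require Import ring_quotient boolp.
From mathcomp Require Import ring.

Set Implicit Arguments.
Unset Strict Implicit.
Unset Printing Implicit Defensive.

Import GRing.Theory.
Local Open Scope ring_scope.

(** Write [A] for [R/(x)] and [m] for the maximal ideal of [R].  As [A] is a
    fiber product, [m/(x)] is a direct sum of nonzero ideals [I/(x)] and
    [J/(x)].  The theorem holds because such a Gorenstein [A] is a node, with
    two discrete valuation rings as components, over which high syzygies are
    2-periodic; then [Ext^t(N, N/(x)N)] with [t] even is nonzero for a nonzero
    high syzygy [N].

    - Ext(-, R) is computed with a finite injective resolution of [R]
      ([ext_vanish]).  A syzygy over [A] of [I/(x)] contains a copy of [J/(x)]
      as a direct summand, and Ext^j(A, R) = 0 for j > n, so the vanishing of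
      Ext^(j+1)(I/(x), R) gives that of Ext^j(J/(x), R) for j > n
      ([fiber_descend]).  Both groups vanish for large j, hence for all j > n
      ([fiber_vanish]), and Ext^j(k, R) = 0 for j > n + 1 ([residue_vanish]).
    - Ext^n(-, R) on [A]-modules is Hom(-, A) ([koszul_generator] states what is
      needed of it).  So vanishing for j = n + 1 extends maps from the
      relations of [I/(x)] to a free cover.  Applied to a Koszul relation
      between two minimal generators, this makes one of them redundant: [I/(x)]
      and [J/(x)] are principal, and each is the annihilator of the other
      ([fiber_principal]).
    - By an argument of Bass, Ext^j(-, R) vanishes on all finitely generated
      modules for j > n + 1 ([ext_vanish_bound]), because it does so on [k].
    - A minimal syzygy over [A] splits as a submodule of a sum of copies of
      [I/(x)] plus one of copies of [J/(x)], and each part is free over a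
      discrete valuation ring ([adapted_cover]); from there on a resolution of
      [M] can be chosen with differentials that are, modulo [(x)], diagonal
      with entries [a] and [b], exchanged at each step ([periodic_resolution]).
    - Let [N] be a high syzygy of [M].  By the previous bound, a cocycle for
      Ext^j(N, N) descends to one for Ext^j(M, M); so Ext^j(N, N) = 0 for j
      from [t] to [t + n] ([syzygy_self_ext]), and dividing out one [x_i] at a
      time, Ext^t(N, N/(x)N) = 0 ([syzygy_self_ext_mod]).  As [t] is even, the
      identity matrix is a cocycle for the latter group; being a coboundary,
      it has its entries in [m].  Hence the free modules have rank 0 at that
      stage. *)

Lemma zmod_start (G : zmodType) (x y : G) : 0 + (x - y) == 0 -> x = y.
Proof. by rewrite add0r subr_eq0 => /eqP. Qed.

(** Proves equalities between signed sums in a commutative group. *)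
Ltac zmod :=
  apply: zmod_start; rewrite ?(opprD, opprK, oppr0, addrA);
  do 400! first
  [ rewrite eqxx; done
  | lazymatch goal with
    | |- is_true (_ + ?x + - ?x == 0) => rewrite addrK
    | |- is_true (_ + - ?x + ?x == 0) => rewrite subrK
    | |- is_true (_ + 0 == 0) => rewrite addr0
    | |- is_true (_ + - ?x == 0) => rewrite (addrAC _ x)
    | |- is_true (_ + ?x == 0) => rewrite (addrAC _ (- x))
    end ]; fail.

(** * Submodules, spans, Nakayama's lemma *)

(** A submodule of [F]; an ideal of [R] is a submodule of [R^o]. *)
Definition submod (R : comNzRingType) (F : lmodType R) (V : F -> Prop) : Prop :=
  V 0 /\ forall c u v, V u -> V v -> V (c *: u + v).

Section Submodules.
Variables (R : comNzRingType) (F : lmodType R).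
Implicit Types (U V W : F -> Prop).

Lemma submod0 V : submod V -> V 0. Proof. by case. Qed.

Lemma submodD V u v : submod V -> V u -> V v -> V (u + v).
Proof. by case=> _ h hu hv; rewrite -[u]scale1r; apply: h. Qed.

Lemma submodZ V c u : submod V -> V u -> V (c *: u).
Proof. by case=> h0 h hu; rewrite -[_ *: _]addr0; apply: h. Qed.

Lemma submodN V u : submod V -> V u -> V (- u).
Proof. by move=> sV hu; rewrite -scaleN1r; apply: submodZ. Qed.

Lemma submodB V u v : submod V -> V u -> V v -> V (u - v).
Proof. by move=> sV hu hv; apply: submodD => //; apply: submodN. Qed.

Lemma submod_sum V (I : finType) (f : I -> F) :
  submod V -> (forall i, V (f i)) -> V (\sum_i f i).
Proof.
move=> sV h; apply: (big_ind V) => //; first exact: submod0.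
by move=> a b; apply: submodD.
Qed.

Lemma submod_zero : submod (fun u : F => u = 0).
Proof. by split=> // c u v -> ->; rewrite scaler0 addr0. Qed.

(** The sum of two submodules. *)
Definition addS U V : F -> Prop := fun w => exists2 u, U u & V (w - u).

Lemma submod_add U V : submod U -> submod V -> submod (addS U V).
Proof.
move=> sU sV; split; first by exists 0; rewrite ?subr0; apply: submod0.
move=> c u v [u1 h1 h1'] [u2 h2 h2']; exists (c *: u1 + u2); first exact: sU.2.
have -> : c *: u + v - (c *: u1 + u2) = c *: (u - u1) + (v - u2).
  by rewrite scalerBr opprD addrACA.
exact: sV.2.
Qed.

Lemma addSl U V u : submod V -> U u -> addS U V u.
Proof. by move=> sV hu; exists u => //; rewrite subrr; apply: submod0. Qed.

Lemma addSr U V u : submod U -> V u -> addS U V u.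
Proof. by move=> sU hu; exists 0; [apply: submod0 | rewrite subr0]. Qed.

(** The span of a finite family. *)
Definition span k (v : 'I_k -> F) : F -> Prop :=
  fun w => exists c : 'I_k -> R, w = \sum_i c i *: v i.

Lemma submod_span k (v : 'I_k -> F) : submod (span v).
Proof.
split; first by exists (fun=> 0); rewrite big1 // => i _; rewrite scale0r.
move=> c u w [a ->] [b ->]; exists (fun i => c * a i + b i).
rewrite scaler_sumr -big_split /=; apply: eq_bigr => i _.
by rewrite scalerDl scalerA.
Qed.

Lemma span_gen k (v : 'I_k -> F) i : span v (v i).
Proof.
exists (fun j => (j == i)%:R); rewrite (bigD1 i) //= eqxx scale1r big1 ?addr0 //.
by move=> j /negbTE ->; rewrite scale0r.
Qed.

Lemma span_sub k (v : 'I_k -> F) V :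
  submod V -> (forall i, V (v i)) -> forall w, span v w -> V w.
Proof.
move=> sV h w [c ->]; apply: submod_sum => // i; exact: submodZ.
Qed.

(** [V] is generated by finitely many elements modulo [U]. *)
Definition fgen_mod U V : Prop :=
  exists k (v : 'I_k -> F), (forall i, V (v i)) /\ forall w, V w -> addS (span v) U w.

(** [V] is finitely generated. *)
Definition fgen V := fgen_mod (fun u => u = 0) V.

Lemma fgen_mod_weaken U V : submod U -> fgen V -> fgen_mod U V.
Proof.
move=> sU [k [v [h1 h2]]]; exists k, v; split=> // w /h2[u hu e].
by exists u => //; rewrite e; apply: submod0.
Qed.

Lemma fgenE V : fgen V -> exists k (v : 'I_k -> F),
  (forall i, V (v i)) /\ forall w, V w -> span v w.
Proof.
move=> [k [v [h1 h2]]]; exists k, v; split=> // w /h2[u hu /eqP].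
by rewrite subr_eq0 => /eqP ->.
Qed.

(** The product [I V] of an ideal and a submodule. *)
Inductive prodS (I : R -> Prop) V : F -> Prop :=
| prodS0 : prodS I V 0
| prodSD c v w : I c -> V v -> prodS I V w -> prodS I V (c *: v + w).

Lemma prodS1 (I : R -> Prop) V c v : I c -> V v -> prodS I V (c *: v).
Proof. by move=> *; rewrite -[_ *: _]addr0; apply: prodSD => //; apply: prodS0. Qed.

Lemma submod_prodS (I : R -> Prop) V : submod V -> submod (prodS I V).
Proof.
move=> sV; split; first exact: prodS0.
move=> c u v + hv; elim=> [|d u' w hd hu' hw ih]; first by rewrite scaler0 add0r.
rewrite scalerDr scalerA mulrC -scalerA -addrA; apply: prodSD => //.
exact: submodZ.
Qed.

Lemma prodS_sub (I : R -> Prop) V U :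
  submod U -> (forall c v, I c -> V v -> U (c *: v)) -> forall w, prodS I V w -> U w.
Proof.
move=> sU h w; elim=> [|c v w' hc hv _ ih]; first exact: submod0.
by apply: submodD => //; apply: h.
Qed.

End Submodules.

Lemma linear_map_exists (R : comNzRingType) (A B : lmodType R) (f : A -> B) :
  (forall c u v, f (c *: u + v) = c *: f u + f v) ->
  exists phi : {linear A -> B}, forall u, phi u = f u.
Proof.
move=> h; pose m := GRing.isLinear.Build R A B *:%R f h.
pose phi : {linear A -> B} := HB.pack f m.
by exists phi.
Qed.

(** A submodule, as a module of its own. *)
Section Submodule.
Variables (R : comNzRingType) (F : lmodType R) (V : F -> Prop) (sV : submod V).

Definition sub_pred : {pred F} := fun u => `[< V u >].

Lemma sub_pred_submod : submod_closed sub_pred.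
Proof.
split; first by apply/asboolP; apply: submod0.
by move=> c u v /asboolP hu /asboolP hv; apply/asboolP; apply: sV.2.
Qed.

HB.instance Definition _ := GRing.isSubmodClosed.Build R F sub_pred sub_pred_submod.

Record sub_type := SubT { sub_val :> F; _ : sub_val \in sub_pred }.

HB.instance Definition _ := [isSub for sub_val].
HB.instance Definition _ := [Choice of sub_type by <:].
HB.instance Definition _ := [SubChoice_isSubLmodule of sub_type by <:].

Lemma submodule_exists : exists (S : lmodType R) (f : {linear S -> F}),
  injective f /\ forall u, V u <-> exists s, f s = u.
Proof.
exists (sub_type : lmodType R).
have [|f hf] := @linear_map_exists R sub_type F sub_val; first by [].
exists f; split; first by move=> a b; rewrite !hf; apply: val_inj.
move=> u; split=> [hu|[s <-]].
  by exists (SubT (introT (asboolP _) hu)); rewrite hf.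
by rewrite hf; case: s => s /= /asboolP.
Qed.

End Submodule.

(** In an injective module, linear maps extend from submodules; the partial
    map is given by a function that need only be linear on the submodule. *)
Lemma injective_extend (R : comNzRingType) (E F : lmodType R) (V : F -> Prop) (g : F -> E) :
  injective_module E -> submod V ->
  (forall c u v, V u -> V v -> g (c *: u + v) = c *: g u + g v) ->
  exists phi : {linear F -> E}, forall v, V v -> phi v = g v.
Proof.
move=> injE sV hg; have [S [f [finj fV]]] := submodule_exists sV.
have Vf s : V (f s) by apply/fV; exists s.
have [h hh] : exists phi : {linear S -> E}, forall u, phi u = g (f u).
  by apply: linear_map_exists => c u v; rewrite linearP hg.
have [phi hphi] := injE S F f h finj.
by exists phi => v /fV[s <-]; rewrite hphi hh.
Qed.

Section LocalRing.
Variables (R : comNzRingType) (m : R -> Prop).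
Hypothesis sm : submod (m : R^o -> Prop).
Hypothesis m_proper : ~ m 1.
Hypothesis m_unit : forall c, ~ m c -> exists d, d * c = 1.

Lemma maxD a b : m a -> m b -> m (a + b).
Proof. exact: (@submodD R R^o m a b sm). Qed.

Lemma maxMl a b : m b -> m (a * b).
Proof. exact: (@submodZ R R^o m a b sm). Qed.

(** Nakayama's lemma for a family of generators, by elimination. *)
Lemma nakayama_gen (F : lmodType R) k (v : 'I_k -> F) (U : F -> Prop) :
  submod U ->
  (forall i, exists c : 'I_k -> R, (forall j, m (c j)) /\ U (v i - \sum_j c j *: v j)) ->
  forall i, U (v i).
Proof.
move=> sU; elim: k v => [|k ih] v h; first by case.
have [c0 [mc0 hc0]] := h ord0.
have [d hd] : exists d, d * (1 - c0 ord0) = 1.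
  by apply: m_unit => /(maxD (mc0 ord0)); rewrite addrC subrK.
pose S0 : F := \sum_j c0 (lift ord0 j) *: v (lift ord0 j).
have hv0 : U (v ord0 - d *: S0).
  have -> : v ord0 - d *: S0 = d *: (v ord0 - \sum_j c0 j *: v j).
    rewrite big_ord_recl -/S0 opprD addrA scalerBr -[X in X - _]scale1r -[X in _ *: (X - _)]scale1r.
    by rewrite -scalerBl scalerA hd.
  exact: submodZ.
have hi : forall i, U (v (lift ord0 i)).
  apply: ih => i; have [c [mc hc]] := h (lift ord0 i).
  exists (fun j => c (lift ord0 j) + c ord0 * d * c0 (lift ord0 j)); split.
    by move=> j; apply: maxD => //; apply: maxMl.
  have -> : v (lift ord0 i)
      - \sum_j (c (lift ord0 j) + c ord0 * d * c0 (lift ord0 j)) *: v (lift ord0 j)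
    = (v (lift ord0 i) - \sum_j c j *: v j) + c ord0 *: (v ord0 - d *: S0).
    under eq_bigr do rewrite scalerDl -!scalerA.
    rewrite big_split /= [in RHS]big_ord_recl -!scaler_sumr -/S0 scalerBr.
    by zmod.
  by apply: submodD => //; apply: submodZ.
move=> i; case: (unliftP ord0 i) => [j ->|->] //.
rewrite -(subrK (d *: S0) (v ord0)); apply: submodD => //.
by apply: submodZ => //; apply: submod_sum => // j; apply: submodZ.
Qed.

(** Nakayama's lemma, for a submodule that is finitely generated modulo [U]. *)
Lemma nakayama (F : lmodType R) (U W : F -> Prop) :
  submod U -> fgen_mod U W ->
  (forall w, W w -> addS U (prodS m W) w) -> forall w, W w -> U w.
Proof.
move=> sU [k [v [vW genW]]] h.
pose Q w := exists c : 'I_k -> R, (forall j, m (c j)) /\ U (w - \sum_j c j *: v j).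
have sQ : submod Q.
  split.
    exists (fun=> 0); split; first by move=> j; apply: (submod0 sm).
    by rewrite big1 ?subr0; [apply: submod0 | move=> j _; rewrite scale0r].
  move=> c u w [a [ma ha]] [b [mb hb]]; exists (fun j => c * a j + b j).
  split; first by move=> j; apply: maxD => //; apply: maxMl.
  have -> : c *: u + w - \sum_j (c * a j + b j) *: v j
     = c *: (u - \sum_j a j *: v j) + (w - \sum_j b j *: v j).
    rewrite scalerBr addrACA -opprD; congr (_ - _).
    rewrite scaler_sumr -big_split /=; apply: eq_bigr => j _.
    by rewrite scalerDl scalerA.
  exact: sU.2.
have mW w : prodS m W w -> Q w.
  apply: prodS_sub => // c w' mc /genW[u [a ->] hu].
  exists (fun j => c * a j); split; first by move=> j; rewrite mulrC; apply: maxMl.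
  under eq_bigr do rewrite -scalerA.
  by rewrite -scaler_sumr -scalerBr; apply: submodZ.
have hv : forall i, U (v i).
  apply: nakayama_gen => // i; have [u hu /mW[c [mc hc]]] := h _ (vW i).
  exists c; split=> //; rewrite -(subrK u (v i)) addrAC; exact: submodD.
move=> w /genW[u hu hw]; rewrite -(subrK u w); apply: submodD => //.
exact: (span_sub sU hv).
Qed.

(** A generating family of minimal size: the coefficients of its relations
    all lie in the maximal ideal. *)
Lemma minimal_generators (F : lmodType R) (U V : F -> Prop) :
  submod U -> fgen_mod U V ->
  exists k (v : 'I_k -> F), [/\ forall i, V (v i),
    forall w, V w -> addS (span v) U w &
    forall c : 'I_k -> R, U (\sum_i c i *: v i) -> forall i, m (c i)].
Proof.
move=> sU hV.
pose P k := exists v : 'I_k -> F, (forall i, V (v i)) /\ forall w, V w -> addS (span v) U w.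
have hP : exists k, `[< P k >] by case: hV => k hk; exists k; apply/asboolP.
case: (ex_minnP hP) => k /asboolP[v [vV genV]] kmin.
exists k, v; split=> // c hc i0; apply: contrapT => /m_unit[d hd].
case: k v vV genV kmin c hc i0 hd => [|k] v vV genV kmin c hc i0 hd; first by case: i0 {hd}.
suff /kmin : `[< P k >] by rewrite ltnn.
apply/asboolP; exists (fun j => v (lift i0 j)); split=> // w /genV[u [a ->] hu].
exists (\sum_j (a (lift i0 j) - a i0 * d * c (lift i0 j)) *: v (lift i0 j)).
  by exists (fun j => a (lift i0 j) - a i0 * d * c (lift i0 j)).
have -> : w - \sum_j (a (lift i0 j) - a i0 * d * c (lift i0 j)) *: v (lift i0 j)
   = (w - \sum_i a i *: v i) + (a i0 * d) *: \sum_i c i *: v i.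
  rewrite !(bigD1_ord i0) //=.
  under eq_bigr do rewrite scalerBl -[(_ * c _) *: _]scalerA.
  rewrite sumrB -scaler_sumr scalerDr scalerA -mulrA hd mulr1.
  by zmod.
by apply: submodD => //; apply: submodZ.
Qed.

End LocalRing.

(** * Noetherian rings and modules *)

(** Every ideal, the unit ideal included, is finitely generated. *)
Definition ideals_fgen (R : comNzRingType) : Prop :=
  forall I : R -> Prop, submod (I : R^o -> Prop) -> fgen (I : R^o -> Prop).

Lemma noetherian_fgen (R : comNzRingType) : noetherian R -> ideals_fgen R.
Proof.
move=> nR I sI; case: (pselect (I 1)) => [I1|nI1].
  exists 1%N, (fun=> 1); split=> // w _; exists w; last by rewrite subrr.
  by exists (fun=> w); rewrite big_ord1 /= [RHS]mulr1.
pose P : {pred R} := fun a => `[< I a >].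
have [|s hs] := nR P.
  split; first by apply/asboolP; apply: (submod0 sI).
    by apply/asboolP.
  by move=> a u v /asboolP hu /asboolP hv; apply/asboolP; apply: sI.2.
exists (size s), (fun i => s`_i); split.
  move=> i; apply/asboolP; rewrite -[asbool _]/(P s`_i) -[P _]/(s`_i \in P) hs.
  apply/asboolP; exists (fun j => (j == i)%:R).
  rewrite (bigD1 i) //= eqxx mul1r big1 ?addr0 // => j /negbTE ->.
  by rewrite mul0r.
move=> w hw; exists w; last by rewrite subrr.
have : w \in P by apply/asboolP.
by rewrite hs => /asboolP[c ->]; exists c.
Qed.

Section Noetherian.
Variable R : comNzRingType.
Hypothesis nR : ideals_fgen R.

(** Submodules of finitely generated modules are finitely generated. *)
Lemma fgen_submod (F : lmodType R) k (v : 'I_k -> F) (V : F -> Prop) :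
  submod V -> (forall w, V w -> span v w) -> fgen V.
Proof.
elim: k v V => [|k ih] v V sV hV.
  exists 0%N, v; split=> [[]//|w /hV hw]; exists w => //; by rewrite subrr.
pose v' j := v (lift ord0 j).
have big c : \sum_i c i *: v i = c ord0 *: v ord0 + \sum_j c (lift ord0 j) *: v' j.
  by rewrite big_ord_recl.
pose I (c : R^o) := exists2 w, span v' w & V (c *: v ord0 + w).
have sI : submod I.
  split; first by exists 0; [apply: (submod0 (submod_span v')) | rewrite scale0r addr0; apply: submod0].
  move=> c a b [u hu hu'] [w hw hw']; exists (c *: u + w).
    exact: (submod_span v').2.
  rewrite scalerDl addrACA -[c *: a]/(c * a) -scalerA -scalerDr; exact: sV.2.
have /fgenE[p [a [ha genI]]] := nR sI.
have /choice[b hb] : forall i, exists w, span v' w /\ V (a i *: v ord0 + w).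
  by move=> i; case: (ha i) => w; exists w.
have [q [g [hg genV']]] : fgen (fun w => V w /\ span v' w).
  apply: (ih v') => [|w []//]; split; first by split; [apply: submod0 | apply: (submod0 (submod_span v'))].
  by move=> c u w [? ?] [? ?]; split; [apply: sV.2 | apply: (submod_span v').2].
pose h (i : 'I_(p + q)) := match split i with
  | inl i => a i *: v ord0 + b i | inr j => g j end.
exists (p + q)%N, h; split.
  by move=> i; rewrite /h; case: split => j; [case: (hb j) | case: (hg j)].
have hl i : span h (a i *: v ord0 + b i).
  have := span_gen h (lshift q i); rewrite {2}/h.
  by case: (split_ordP (lshift q i)) => j; [move=> /lshift_inj -> | move=> /eqP; rewrite eq_lrshift].
have hr i : span h (g i).
  have := span_gen h (rshift p i); rewrite {2}/h.
  by case: (split_ordP (rshift p i)) => j; [move=> /eqP; rewrite eq_rlshift | move=> /rshift_inj ->].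
move=> w hw; exists w; last by rewrite subrr.
have [c ec] := hV _ hw.
have /genI[e ee] : I (c ord0).
  exists (\sum_j c (lift ord0 j) *: v' j); first by exists (fun j => c (lift ord0 j)).
  by rewrite -big -ec.
pose w1 := \sum_i e i *: (a i *: v ord0 + b i).
have hw1 : span h w1.
  by apply: submod_sum => [|i]; [apply: submod_span | apply: submodZ => //; apply: submod_span].
have Vw1 : V w1 by apply: submod_sum => // i; apply: submodZ => //; case: (hb i).
rewrite -(subrK w1 w); apply: (submodD (submod_span h)) => //.
have /genV'[u hu /eqP] : V (w - w1) /\ span v' (w - w1).
  split; first exact: submodB.
  have -> : w - w1 = \sum_j c (lift ord0 j) *: v' j - \sum_i e i *: b i.
    rewrite ec big /w1; under [X in _ - X]eq_bigr do rewrite scalerDr scalerA.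
    rewrite big_split /= -scaler_suml ee.
    have -> : \sum_i e i *: a i = \sum_i e i * a i by [].
    by rewrite opprD addrA [X in X - _]addrAC subrr add0r.
  apply: (submodB (submod_span v')); first by exists (fun j => c (lift ord0 j)).
  apply: (submod_sum (submod_span v')) => i; apply: (submodZ _ (submod_span v')).
  by case: (hb i).
by rewrite subr_eq0 => /eqP ->; apply: (span_sub (submod_span h) hr).
Qed.

(** Noetherian induction on ideals. *)
Lemma ideal_ind (P : (R -> Prop) -> Prop) :
  (forall I, submod (I : R^o -> Prop) ->
     (forall J, submod (J : R^o -> Prop) -> (forall c, I c -> J c) ->
        (exists2 c, J c & ~ I c) -> P J) -> P I) ->
  forall I, submod (I : R^o -> Prop) -> P I.
Proof.
move=> step I0 sI0; apply: contrapT => nP0.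
pose T := {I : R -> Prop | submod (I : R^o -> Prop) /\ ~ P I}.
have /choice[f hf] : forall I : T, exists J : T,
    (forall c, sval I c -> sval J c) /\ exists2 c, sval J c & ~ sval I c.
  move=> [I [sI nP]] /=; apply: contrapT => h; apply: nP; apply: step => // J sJ IJ hJ.
  by apply: contrapT => nPJ; apply: h; exists (exist _ J (conj sJ nPJ)).
pose s k := iter k f (exist _ I0 (conj sI0 nP0)).
have mono i j c : (i <= j)%N -> sval (s i) c -> sval (s j) c.
  move=> /subnKC <- hc; elim: (j - i)%N => [|k ih]; first by rewrite addn0.
  by rewrite addnS; apply: (hf _).1.
pose U (c : R^o) := exists k, sval (s k) c.
have sU : submod U.
  split; first by exists 0%N; apply: (submod0 sI0).
  move=> c u v [i hi] [j hj]; exists (maxn i j).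
  apply: (svalP (s (maxn i j))).1.2; [exact: mono (leq_maxl _ _) hi | exact: mono (leq_maxr _ _) hj].
have /fgenE[k [v [/choice[n hn] gen]]] := nR sU.
pose N := \max_i n i.
have [_ [c hc nc]] := hf (s N); apply: nc.
have /gen : U c by exists N.+1.
apply: (span_sub (svalP (s N)).1) => i; apply: mono (hn i).
exact: leq_bigmax.
Qed.

End Noetherian.

(** * The functors Ext(-, R) through an injective resolution of the ring *)

Section ExtDef.
Variables (R : comNzRingType) (E : injective_resolution (R^o : lmodType R)).

(** Vanishing of Ext^(j+1)(V/U, R) for submodules [U] and [V] of [F], with [U]
    contained in [V].  Since the terms of the resolution [E] are injective, maps
    from [V/U] to them are the restrictions to [V] of maps defined on [F] that
    vanish on [U]; so no quotient module occurs. *)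
Definition ext_vanish (F : lmodType R) (j : nat) (U V : F -> Prop) : Prop :=
  forall phi : {linear F -> E j.+1},
    (forall u, U u -> phi u = 0) -> (forall v, V v -> ir_d E _ (phi v) = 0) ->
  exists psi : {linear F -> E j},
    (forall u, U u -> psi u = 0) /\ forall v, V v -> phi v = ir_d E _ (psi v).

End ExtDef.

Section Ext.
Variables (R : comNzRingType) (E : injective_resolution (R^o : lmodType R)).

Local Notation d := (ir_d E _).
Local Notation all_of F := (fun _ : F => True).

Lemma ir_dd i (z : E i) : d (d z) = 0.
Proof. by apply/ir_exactS; exists z. Qed.

Section Triple.
Variables (F : lmodType R) (U V W : F -> Prop).
Hypothesis UV : forall u, U u -> V u.
Hypothesis VW : forall u, V u -> W u.

(** The three pieces of the long exact sequence of
    0 -> V/U -> W/U -> W/V -> 0. *)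
Lemma ext_vanish_mid j :
  ext_vanish E j U V -> ext_vanish E j V W -> ext_vanish E j U W.
Proof.
move=> h1 h2 phi hU hW; have [|psi [psiU hpsi]] := h1 phi hU.
  by move=> v /VW /hW.
have [||chi [chiV hchi]] := h2 (phi \- (d \o psi) : {linear F -> _}).
- by move=> u hu /=; rewrite hpsi // subrr.
- by move=> v hv /=; rewrite linearB /= ir_dd subr0 hW.
exists (psi \+ chi : {linear F -> _}); split=> [u hu|v hv] /=.
  by rewrite psiU // chiV ?addr0 //; apply: UV.
by rewrite linearD -hchi //= addrC subrK.
Qed.

Lemma ext_vanish_sub j :
  ext_vanish E j U W -> ext_vanish E j.+1 V W -> ext_vanish E j U V.
Proof.
move=> h1 h2 phi hU hV.
have [||psi [psiV hpsi]] := h2 (d \o phi : {linear F -> _}).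
- by move=> u hu /=; rewrite hV.
- by move=> v hv /=; rewrite ir_dd.
have [||chi [chiU hchi]] := h1 (phi \- psi : {linear F -> _}).
- by move=> u hu /=; rewrite hU // psiV ?subrr //; apply: UV.
- by move=> v hv /=; rewrite linearB /= -hpsi //= subrr.
exists chi; split=> // v hv; rewrite -hchi /=; last exact: VW.
by rewrite psiV // subr0.
Qed.

Lemma ext_vanish_quo j :
  ext_vanish E j U V -> ext_vanish E j.+1 U W -> ext_vanish E j.+1 V W.
Proof.
move=> h1 h2 phi hV hW.
have [|//|psi [psiU hpsi]] := h2 phi; first by move=> u /UV /hV.
have [//||chi [chiU hchi]] := h1 psi.
  by move=> v hv; rewrite -hpsi ?hV //; apply: VW.
exists (psi \- (d \o chi) : {linear F -> _}); split=> [v hv|v hv] /=.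
  by rewrite -hchi // subrr.
by rewrite linearB /= ir_dd subr0 hpsi.
Qed.

End Triple.

(** Invariance: if [theta] induces an isomorphism of [F] modulo the preimage
    of [U] with [V/U], vanishing passes from [V/U] to the former. *)
Lemma ext_vanish_transfer (F F' : lmodType R) (theta : {linear F -> F'}) j
    (U V : F' -> Prop) :
  submod U -> submod V -> (forall u, U u -> V u) -> (forall u, V (theta u)) ->
  (forall v, V v -> exists u, U (v - theta u)) ->
  ext_vanish E j U V -> ext_vanish E j (fun u => U (theta u)) (all_of F).
Proof.
move=> sU sV UV thV Vth h phi phiU phid.
have wd u u' : U (theta u - theta u') -> phi u = phi u'.
  by move=> hu; apply/eqP; rewrite -subr_eq0 -linearB phiU // linearB.
have /choice[r hr] : forall v, exists u, V v -> U (v - theta u).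
  by move=> v; case: (pselect (V v)) => [/Vth[u hu]|hv]; [exists u | exists 0].
have rE v u : V v -> U (v - theta u) -> phi (r v) = phi u.
  move=> hv hu; apply: wd.
  have -> : theta (r v) - theta u = (v - theta u) - (v - theta (r v)) by zmod.
  by apply: submodB => //; apply: hr.
have [|phi' hphi'] := @injective_extend R (E j.+1) F' V (phi \o r)
  (@ir_injective _ _ E _) sV.
- move=> c u v hu hv; rewrite /= -linearP; apply: rE; first exact: sV.2.
  rewrite linearP.
  have -> : c *: u + v - (c *: theta (r u) + theta (r v))
     = c *: (u - theta (r u)) + (v - theta (r v)) by rewrite scalerBr; zmod.
  by apply: sU.2; apply: hr.
have phi'th u : phi' (theta u) = phi u.
  by rewrite hphi' //=; apply: rE => //; rewrite subrr; apply: submod0.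
have [||psi [psiU hpsi]] := h phi'.
- move=> u hu; rewrite hphi'; last exact: UV.
  have hu' := UV _ hu; by rewrite /= (rE u 0) ?raddf0 ?linear0 ?subr0 ?addr0.
- move=> v hv; rewrite hphi' //=; exact: phid.
exists (psi \o theta : {linear F -> _}); split=> [u hu|u _] /=; first exact: psiU.
by rewrite -phi'th hpsi.
Qed.

(** Vanishing for the quotient of an ideal [K] by [I], tested on elements. *)
Lemma ext_vanish_idealP j (I K : R -> Prop) :
  ext_vanish E j (I : R^o -> Prop) (K : R^o -> Prop) <->
  forall e : E j.+1, (forall c, I c -> c *: e = 0) -> (forall c, K c -> c *: d e = 0) ->
  exists e' : E j, (forall c, I c -> c *: e' = 0) /\ forall c, K c -> c *: e = c *: d e'.
Proof.
split=> [h e eI eK|h phi phiI phiK].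
  have [phi hphi] : exists phi : {linear R^o -> E j.+1}, forall c, phi c = c *: e.
    by apply: linear_map_exists => c u v; rewrite scalerDl -scalerA.
  have [||psi [psiI psiK]] := h phi.
  - by move=> u hu; rewrite hphi eI.
  - by move=> u hu; rewrite hphi linearZ /= eK.
  have psiE c : psi c = c *: psi 1 by rewrite -linearZ /= [_ *: _]mulr1.
  exists (psi 1); split=> [c hc|c hc]; first by rewrite -psiE psiI.
  by rewrite -hphi -linearZ /= -psiE psiK.
have phiE c : phi c = c *: phi 1 by rewrite -linearZ /= [_ *: _]mulr1.
have [||e' [e'I e'K]] := h (phi 1).
- by move=> c hc; rewrite -phiE phiI.
- by move=> c hc; rewrite -linearZ /= -phiE phiK.
have [psi hpsi] : exists psi : {linear R^o -> E j}, forall c, psi c = c *: e'.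
  by apply: linear_map_exists => c u v; rewrite scalerDl -scalerA.
exists psi; split=> [u hu|u hu]; first by rewrite hpsi e'I.
by rewrite phiE e'K // hpsi linearZ.
Qed.

(** The module generated by [V] and [g] is, modulo [V], a cyclic module. *)
Lemma ext_vanish_cyclic (F : lmodType R) j (V : F -> Prop) g :
  submod V ->
  ext_vanish E j ((fun c => V (c *: g)) : R^o -> Prop) (all_of R^o) ->
  ext_vanish E j V (addS (fun u => exists c, u = c *: g) V).
Proof.
move=> sV /ext_vanish_idealP h phi phiV phid.
have sG : submod (fun u => exists c, u = c *: g).
  split; first by exists 0; rewrite scale0r.
  by move=> c u v [a ->] [b ->]; exists (c * a + b); rewrite scalerDl scalerA.
have [||e [eV he]] := h (phi g).
- by move=> c hc; rewrite -linearZ /= phiV.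
- move=> c _; rewrite phid ?scaler0 //; apply: addSl => //.
  by exists 1; rewrite scale1r.
have := he 1 I; rewrite !scale1r => {}he.
have /choice[r hr] : forall v, exists c, addS (fun u => exists c, u = c *: g) V v -> V (v - c *: g).
  move=> v; case: (pselect (addS (fun u => exists c, u = c *: g) V v)) => [[u [c ->] hu]|hv];
    [by exists c | by exists 0].
have rE v c : addS (fun u => exists c, u = c *: g) V v -> V (v - c *: g) -> r v *: e = c *: e.
  move=> hv hc; apply/eqP; rewrite -subr_eq0 -scalerBl eV // scalerBl.
  have -> : r v *: g - c *: g = (v - c *: g) - (v - r v *: g) by zmod.
  by apply: submodB => //; apply: hr.
have [|psi hpsi] := @injective_extend R (E j) F _ (fun v => r v *: e)
  (@ir_injective _ _ E _) (submod_add sG sV).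
- move=> c u v hu hv; rewrite scalerA -scalerDl; apply: rE.
    exact: (submod_add sG sV).2.
  have -> : c *: u + v - (c * r u + r v) *: g = c *: (u - r u *: g) + (v - r v *: g).
    by rewrite scalerBr scalerDl scalerA; zmod.
  by apply: sV.2; apply: hr.
exists psi; split=> [u hu|v hv].
  have hu' : addS (fun u => exists c, u = c *: g) V u by apply: addSr.
  by rewrite hpsi // (rE u 0) ?scale0r ?subr0.
rewrite hpsi // linearZ /= -he -linearZ /=; apply/eqP.
by rewrite -subr_eq0 -linearB phiV //; apply: hr.
Qed.

End Ext.

(** * The modules Ext(R/(x), R) for a regular sequence *)

Section Koszul.
Variables (R : comNzRingType) (x : nat -> R).

(** The ideal generated by the first [l] terms of the sequence [x]. *)
Fixpoint seq_ideal (l : nat) : R -> Prop :=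
  if l is l'.+1 then fun c => exists d, seq_ideal l' (c - d * x l') else fun c => c = 0.

Lemma submod_seq_ideal l : submod (seq_ideal l : R^o -> Prop).
Proof.
elim: l => [|l ih]; first exact: submod_zero.
split; first by exists 0; rewrite mul0r subrr; apply: (submod0 ih).
move=> c u v [a ha] [b hb]; exists (c * a + b).
have -> : c *: (u : R^o) + v - (c * a + b) * x l = c *: ((u - a * x l) : R^o) + (v - b * x l).
  by rewrite /GRing.scale /=; ring.
exact: ih.2.
Qed.

Lemma seq_ideal_incl l c : seq_ideal l c -> seq_ideal l.+1 c.
Proof. by move=> h; exists 0; rewrite mul0r subr0. Qed.

Lemma seq_ideal_le k l c : (k <= l)%N -> seq_ideal k c -> seq_ideal l c.
Proof.
move=> /subnKC <- h; elim: (l - k)%N => [|i ih]; first by rewrite addn0.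
by rewrite addnS; apply: seq_ideal_incl.
Qed.

Lemma seq_ideal_last l c : seq_ideal l.+1 (c * x l).
Proof. by exists c; rewrite subrr; apply: (submod0 (submod_seq_ideal l)). Qed.

Variable n : nat.
Hypothesis regx : forall l, (l < n)%N -> forall c, seq_ideal l (x l * c) -> seq_ideal l c.
Variable E : injective_resolution (R^o : lmodType R).

Local Notation d := (ir_d E _).

(** The elements annihilated by [I], that is, maps from [R/I] to the module. *)
Definition killed (I : R -> Prop) (F : lmodType R) (e : F) : Prop := forall c, I c -> c *: e = 0.

Lemma submod_killed (I : R -> Prop) (F : lmodType R) : submod (@killed I F).
Proof.
split; first by move=> c _; rewrite scaler0.
move=> c u v hu hv a ha; rewrite scalerDr scalerA mulrC -scalerA hu // hv //.
by rewrite scaler0 addr0.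
Qed.

Lemma killed_lin (I : R -> Prop) (F F' : lmodType R) (f : {linear F -> F'}) e :
  killed I e -> killed I (f e).
Proof. by move=> h c hc; rewrite -linearZ /= h // linear0. Qed.

(** If [y] is a nonzerodivisor on [R/I], multiplication by [y] is onto on the
    [I]-torsion of an injective module. *)
Lemma killed_divisible (I : R -> Prop) y i (e : E i) :
  submod (I : R^o -> Prop) -> (forall c, I (y * c) -> I c) -> killed I e ->
  exists2 e' : E i, killed I e' & y *: e' = e.
Proof.
move=> sI hy eI.
pose V (v : R^o) := exists c, I (v - c * y).
have sV : submod V.
  split; first by exists 0; rewrite mul0r subrr; apply: (submod0 sI).
  move=> c u v [a ha] [b hb]; exists (c * a + b).
  have -> : c *: (u : R^o) + v - (c * a + b) * y = c *: ((u - a * y) : R^o) + (v - b * y).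
    by rewrite /GRing.scale /=; ring.
  exact: sI.2.
have /choice[r hr] : forall v, exists c, V v -> I (v - c * y).
  by move=> v; case: (pselect (V v)) => [[c hc]|hv]; [exists c | exists 0].
have rE v c : V v -> I (v - c * y) -> r v *: e = c *: e.
  move=> hv hc; apply/eqP; rewrite -subr_eq0 -scalerBl eI //; apply: hy.
  have -> : y * (r v - c) = (v - c * y) - (v - r v * y) by ring.
  by apply: (submodB sI) => //; apply: hr.
have [|phi hphi] := @injective_extend R (E i) R^o V (fun v => r v *: e)
  (@ir_injective _ _ E _) sV.
  move=> c u v hu hv; rewrite scalerA -scalerDl; apply: rE; first exact: sV.2.
  have -> : c *: u + v - (c * r u + r v) * y = c *: ((u - r u * y) : R^o) + (v - r v * y).
    by rewrite /GRing.scale /=; ring.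
  by apply: sI.2; apply: hr.
have phiE c : phi c = c *: phi 1 by rewrite -linearZ /= [_ *: _]mulr1.
exists (phi 1) => [c hc|]; rewrite -phiE.
  have hV : V c by exists 0; rewrite mul0r subr0.
  by rewrite hphi // (rE c 0) ?scale0r // mul0r subr0.
have hV : V y by exists 1; rewrite mul1r subrr; apply: (submod0 sI).
by rewrite hphi // (rE y 1) ?scale1r // mul1r subrr; apply: (submod0 sI).
Qed.

(** Ext^j(R/(x_0,..,x_(l-1)), R) = 0 for j > l. *)
Lemma koszul_vanish l j (e : E j.+1) : (l <= n)%N -> (l <= j)%N ->
  killed (seq_ideal l) e -> d e = 0 ->
  exists2 e' : E j, killed (seq_ideal l) e' & e = d e'.
Proof.
elim: l j e => [|l ih] j e ln lj ke de.
  have /ir_exactS[e' he'] := de.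
  by exists e' => // c ->; rewrite scale0r.
have [e1 ke1 he1] := ih _ e (ltnW ln) (ltnW lj) (fun c hc => ke c (seq_ideal_incl hc)) de.
case: j lj e ke de e1 ke1 he1 => // j lj e ke de e1 ke1 he1.
have [||e2 ke2 he2] := ih _ (x l *: e1) (ltnW ln) lj.
- exact: (submodZ _ (@submod_killed _ _)).
- rewrite linearZ /= -he1; apply: ke.
  by rewrite -[x l]mul1r; apply: seq_ideal_last.
have [e3 ke3 he3] := killed_divisible (submod_seq_ideal l) (regx ln) ke2.
exists (e1 - d e3); last by rewrite linearB /= ir_dd subr0.
move=> c [a ha].
have ke4 : killed (seq_ideal l) (e1 - d e3).
  by apply: (submodB (@submod_killed _ _)) => //; apply: killed_lin.
rewrite -(subrK (a * x l) c) scalerDl ke4 // add0r -scalerA scalerBr he2.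
by rewrite -linearZ /= he3 subrr scaler0.
Qed.

Lemma koszul_ext_vanish l j : (l <= n)%N -> (l <= j)%N ->
  ext_vanish E j (seq_ideal l : R^o -> Prop) (fun _ : R^o => True).
Proof.
move=> ln lj; apply/ext_vanish_idealP => e ke de.
have [|e' h1 h2] := koszul_vanish ln lj ke; first by rewrite -[LHS]scale1r de.
by exists e'; split=> // c _; rewrite h2.
Qed.

(** Coboundaries of Hom(R/I, E). *)
Definition coboundary (I : R -> Prop) (l : nat) : E l -> Prop :=
  match l with
  | 0 => fun e => e = 0
  | l'.+1 => fun e => exists2 e' : E l', killed I e' & d e' = e
  end.

Lemma submod_coboundary I l : submod (@coboundary I l).
Proof.
case: l => [|l]; first exact: submod_zero.
split; first by exists 0; [apply: (submod0 (@submod_killed _ _)) | rewrite linear0].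
move=> c u v [a ha <-] [b hb <-]; exists (c *: a + b); last by rewrite linearP.
exact: (@submod_killed _ _).2.
Qed.

Lemma coboundary_d (I : R -> Prop) l (e : E l) : coboundary I e -> d e = 0.
Proof. by case: l e => [|l] e /= => [->|[e' _ <-]]; rewrite ?linear0 ?ir_dd. Qed.

Lemma coboundary_killed (I : R -> Prop) l (e : E l) : coboundary I e -> killed I e.
Proof.
case: l e => [|l] e /=; first by move=> -> c _; rewrite scaler0.
by move=> [e' k <-]; apply: killed_lin.
Qed.

Lemma coboundary_divisible (I : R -> Prop) y l (e : E l) :
  submod (I : R^o -> Prop) -> (forall c, I (y * c) -> I c) -> coboundary I e ->
  exists2 e' : E l, coboundary I e' & y *: e' = e.
Proof.
move=> sI hy; case: l e => [|l] e /=; first by move=> ->; exists 0; rewrite ?scaler0.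
move=> [e1 /(killed_divisible sI hy)[e2 k2 <-] <-].
by exists (d e2); [exists e2 | rewrite linearZ].
Qed.

(** Ext^l(R/(x_0,..,x_(l-1)), R) is isomorphic to R/(x_0,..,x_(l-1)): a
    generator [e] with annihilator [seq_ideal l]. *)
Lemma koszul_generator l : (l <= n)%N -> exists e : E l,
  [/\ killed (seq_ideal l) e, d e = 0,
      forall e' : E l, killed (seq_ideal l) e' -> d e' = 0 ->
        exists c, coboundary (seq_ideal l) (e' - c *: e) &
      forall c, coboundary (seq_ideal l) (c *: e) -> seq_ideal l c].
Proof.
elim: l => [|l ih] ln.
  have augE c : ir_aug E c = c *: ir_aug E 1 by rewrite -linearZ /= [_ *: _]mulr1.
  exists (ir_aug E 1); split.
  - by move=> c ->; rewrite scale0r.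
  - by apply/ir_exact0; exists 1.
  - by move=> e' _ /ir_exact0[w <-]; exists w; rewrite /= -augE subrr.
  - move=> c /=; rewrite -augE => h; apply: (@ir_aug_inj _ _ E).
    by rewrite h linear0.
have [e [ke de gen faith]] := ih (ltnW ln).
have sl := submod_seq_ideal l.
have [f kf hf] := killed_divisible sl (regx ln) ke.
exists (d f); split.
- move=> c [a ha]; rewrite -(subrK (a * x l) c) scalerDl (killed_lin _ kf) // add0r.
  by rewrite -scalerA -[x l *: _]linearZ /= hf de scaler0.
- exact: ir_dd.
- move=> e' ke' de'.
  have [e1 ke1 he1] := koszul_vanish (ltnW ln) (leqnn l) (fun c hc => ke' c (seq_ideal_incl hc)) de'.
  have [||c hc] := gen (x l *: e1).
  + exact: (submodZ _ (@submod_killed _ _)).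
  + rewrite linearZ /= -he1; apply: ke'.
    by rewrite -[x l]mul1r; apply: seq_ideal_last.
  have [b cb hb] := coboundary_divisible sl (regx ln) hc.
  exists c; exists (e1 - c *: f - b).
    move=> a [a' ha'].
    have k' : killed (seq_ideal l) (e1 - c *: f - b).
      have sk := @submod_killed (seq_ideal l) (E l).
      apply: (submodB sk); last exact: coboundary_killed.
      by apply: (submodB sk) => //; apply: (submodZ _ sk).
    rewrite -(subrK (a' * x l) a) scalerDl k' // add0r -scalerA !(scalerBr (x l)) hb.
    by rewrite [x l *: (c *: f)]scalerA [x l * c]mulrC -scalerA hf subrr scaler0.
  by rewrite !linearB linearZ /= (coboundary_d cb) subr0 he1.
- move=> c [e' ke' he'].
  have [||c' hc'] := gen (c *: f - e').
  + have sk := @submod_killed (seq_ideal l) (E l).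
    apply: (submodB sk); first exact: (submodZ _ sk).
    by move=> a ha; apply: ke'; apply: seq_ideal_incl.
  + by rewrite linearB linearZ /= he' subrr.
  exists c'; apply: faith.
  have -> : (c - c' * x l) *: e = x l *: (c *: f - e' - c' *: e).
    rewrite !scalerBr [x l *: e']ke'; last by rewrite -[x l]mul1r; apply: seq_ideal_last.
    by rewrite subr0 !scalerA [x l * c]mulrC -[(c * _) *: _]scalerA hf scalerBl [x l * c']mulrC.
  exact: (submodZ _ (submod_coboundary _ _)).
Qed.

End Koszul.

(** * Free modules of row vectors *)

Section Rows.
Variable R : comNzRingType.

(** Row vectors with all their entries in [P]; when [P] is an ideal, the product
    of [P] and the free module. *)
Definition allin k (P : R -> Prop) (u : 'rV[R]_k) : Prop := forall i, P (u 0 i).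

Lemma submod_allin k (P : R -> Prop) :
  submod (P : R^o -> Prop) -> submod (@allin k P).
Proof.
move=> sP; split; first by move=> i; rewrite mxE; apply: (submod0 sP).
by move=> c u v hu hv i; rewrite !mxE; apply: sP.2.
Qed.

(** The linear map with given values on the standard basis. *)
Lemma row_map (A : lmodType R) k (v : 'I_k -> A) :
  exists phi : {linear 'rV[R]_k -> A}, forall u, phi u = \sum_i u 0 i *: v i.
Proof.
apply: linear_map_exists => c u w; rewrite scaler_sumr -big_split /=; apply: eq_bigr => i _.
by rewrite !mxE scalerDl scalerA.
Qed.

Lemma row_mapE (A : lmodType R) k (phi : {linear 'rV[R]_k -> A}) u :
  phi u = \sum_i u 0 i *: phi (delta_mx 0 i).
Proof.
by rewrite {1}[u]row_sum_delta linear_sum; apply: eq_bigr => i _; rewrite linearZ.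
Qed.

Lemma sum_delta (A : lmodType R) k (v : 'I_k -> A) i :
  \sum_j (delta_mx 0 i : 'rV[R]_k) 0 j *: v j = v i.
Proof.
rewrite (bigD1 i) //= mxE !eqxx scale1r big1 ?addr0 // => j /negbTE ji.
by rewrite mxE ji andbF scale0r.
Qed.

Lemma row_span k : forall u : 'rV[R]_k, True -> span (fun i => delta_mx 0 i) u.
Proof. by move=> u _; exists (fun i => u 0 i); rewrite -row_sum_delta. Qed.

Variable E : injective_resolution (R^o : lmodType R).
Local Notation d := (ir_d E _).

Lemma ext_vanish_allin k j (I : R -> Prop) : submod (I : R^o -> Prop) ->
  ext_vanish E j (I : R^o -> Prop) (fun _ : R^o => True) ->
  ext_vanish E j (@allin k I) (fun=> True).
Proof.
move=> sI /ext_vanish_idealP h phi kphi dphi.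
have /choice[e he] : forall i : 'I_k, exists e : E j,
    killed I e /\ phi (delta_mx 0 i) = d e.
  move=> i; have [||e [h1 h2]] := h (phi (delta_mx 0 i)).
  - move=> c hc; rewrite -linearZ /= kphi // => l; rewrite !mxE.
    by case: (_ && _); rewrite ?mulr1 ?mulr0 //; apply: (submod0 sI).
  - by move=> c _; rewrite dphi ?scaler0.
  by exists e; split=> //; have := h2 1 Logic.I; rewrite !scale1r.
have [psi hpsi] := row_map e; exists psi; split=> [u hu|u _].
  by rewrite hpsi big1 // => i _; apply: (he i).1.
rewrite row_mapE hpsi linear_sum; apply: eq_bigr => i _.
by rewrite linearZ /= (he i).2.
Qed.

(** Free modules of finite rank have no higher Ext. *)
Lemma ext_vanish_free k j : ext_vanish E j (fun u : 'rV[R]_k => u = 0) (fun=> True).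
Proof.
move=> phi _ dphi.
have /choice[e he] : forall i : 'I_k, exists e : E j, d e = phi (delta_mx 0 i).
  by move=> i; apply/ir_exactS; apply: dphi.
have [psi hpsi] := row_map e; exists psi; split=> [u ->|u _]; first exact: linear0.
rewrite row_mapE hpsi linear_sum; apply: eq_bigr => i _.
by rewrite linearZ /= he.
Qed.

End Rows.

(** * Fiber products: vanishing of Ext forces principal components *)

Section FiberIdeals.
Variables (R : comNzRingType) (m : R -> Prop).
Hypothesis sm : submod (m : R^o -> Prop).
Hypothesis m_proper : ~ m 1.
Hypothesis m_unit : forall c, ~ m c -> exists d, d * c = 1.
Hypothesis nR : ideals_fgen R.
Variables (x : nat -> R) (n : nat).
Hypothesis regx : forall l, (l < n)%N -> forall c, seq_ideal x l (x l * c) -> seq_ideal x l c.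
Variable E : injective_resolution (R^o : lmodType R).
Local Notation d := (ir_d E _).
Local Notation al := (seq_ideal x n).

(** [m/(x)] is the direct sum of the nonzero ideals [I/(x)] and [J/(x)]. *)
Record fiber_ideals (I J : R -> Prop) : Prop := FiberIdeals {
  fib_sI : submod (I : R^o -> Prop);
  fib_sJ : submod (J : R^o -> Prop);
  fib_aI : forall c, al c -> I c;
  fib_aJ : forall c, al c -> J c;
  fib_IJ : forall c, I c -> J c -> al c;
  fib_m : forall c, m c <-> exists2 i, I i & J (c - i);
  fib_I : exists2 c, I c & ~ al c;
  fib_J : exists2 c, J c & ~ al c }.

Lemma fiber_ideals_sym I J : fiber_ideals I J -> fiber_ideals J I.
Proof.
case=> sI sJ aI aJ IJ mE hI hJ; split=> //; first by move=> c ? ?; apply: IJ.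
move=> c; split=> [/mE[i hi hj]|[j hj hi]].
  by exists (c - i) => //; rewrite opprB addrC subrK.
by apply/mE; exists (c - j) => //; rewrite opprB addrC subrK.
Qed.

Let sal : submod (al : R^o -> Prop) := submod_seq_ideal x n.

Section Fixed.
Variables I J : R -> Prop.
Hypothesis fIJ : fiber_ideals I J.
Let sI := fib_sI fIJ.
Let sJ := fib_sJ fIJ.

Lemma fiber_mI c : I c -> m c.
Proof. by move=> h; apply/(fib_m fIJ); exists c => //; rewrite subrr; apply: (submod0 sJ). Qed.

Lemma fiber_mJ c : J c -> m c.
Proof. by move=> h; apply/(fib_m fIJ); exists 0; rewrite ?subr0 //; apply: (submod0 sI). Qed.

Lemma fiber_mul i j : I i -> J j -> al (j * i).
Proof.
move=> hi hj; apply: (fib_IJ fIJ); first exact: (submodZ _ sI).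
by rewrite mulrC; apply: (submodZ _ sJ).
Qed.

(** On a submodule [Z] of a free module whose [i0]-th coordinates lie in [m],
    the map to the [J]-component of the [i0]-th coordinate, times [e], is the
    restriction of a linear map. *)
Lemma fiber_component k (Z : 'rV[R]_k -> Prop) i0 i (e : E i) :
  submod Z -> (forall z, Z z -> m (z 0 i0)) -> killed al e ->
  exists phi : {linear 'rV[R]_k -> E i},
    forall z j, Z z -> J j -> I (z 0 i0 - j) -> phi z = j *: e.
Proof.
move=> sZ Zm ke.
have /choice[r hr] : forall z, exists j, Z z -> J j /\ I (z 0 i0 - j).
  move=> z; case: (pselect (Z z)) => [/Zm /(fib_m (fiber_ideals_sym fIJ))[j hj hi]|hz];
    by [exists j | exists 0].
have rE z j : Z z -> J j -> I (z 0 i0 - j) -> r z *: e = j *: e.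
  move=> hz hj hi; have [hj' hi'] := hr z hz.
  apply/eqP; rewrite -subr_eq0 -scalerBl ke //; apply: (fib_IJ fIJ).
    have -> : r z - j = (z 0 i0 - j) - (z 0 i0 - r z) by ring.
    exact: (submodB sI).
  exact: (submodB sJ).
have [|phi hphi] := @injective_extend R (E i) _ Z (fun z => r z *: e) (@ir_injective _ _ E _) sZ.
  move=> c u v hu hv; rewrite scalerA -scalerDl; have [ju iu] := hr u hu; have [jv iv] := hr v hv.
  apply: rE; first exact: sZ.2.
    exact: sJ.2.
  rewrite !mxE.
  have -> : c * u 0 i0 + v 0 i0 - (c * r u + r v) = c * (u 0 i0 - r u) + (v 0 i0 - r v) by ring.
  exact: sI.2.
by exists phi => z j hz hj hi; rewrite hphi //; apply: rE.
Qed.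

(** A minimal free cover of [I/(x)]: its relations have their entries in [m]. *)
Lemma fiber_cover : exists k (y : 'I_k.+1 -> R),
  [/\ forall i, I (y i), forall c, I c -> exists a : 'I_k.+1 -> R, al (c - \sum_i a i * y i)
    & forall z : 'rV[R]_k.+1, al (\sum_i z 0 i * y i) -> allin m z].
Proof.
have [k [y [yI gen ymin]]] := minimal_generators m_unit sal
  (fgen_mod_weaken sal (nR sI)).
case: k y yI gen ymin => [|k] y yI gen ymin.
  have [c /gen[u [a ->] h] nc] := fib_I fIJ.
  by case: nc; rewrite big_ord0 subr0 in h.
exists k, y; split=> // [c /gen[u [a ->] h]|z hz i]; first by exists a.
exact: (ymin (fun i => z 0 i)).
Qed.

(** [I/(x)] is the quotient of the free module by the relations. *)
Lemma fiber_relations k (y : 'I_k -> R) (theta : {linear 'rV[R]_k -> R^o}) j :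
  (forall i, I (y i)) -> (forall c, I c -> exists a : 'I_k -> R, al (c - \sum_i a i * y i)) ->
  (forall u, theta u = \sum_i u 0 i *: (y i : R^o)) ->
  ext_vanish E j (al : R^o -> Prop) (I : R^o -> Prop) ->
  ext_vanish E j (fun u => al (theta u)) (fun _ => True).
Proof.
move=> yI gen hth; apply: ext_vanish_transfer => //.
- exact: fib_aI fIJ.
- move=> u; rewrite hth; apply: (submod_sum sI) => i.
  exact: (submodZ _ sI).
- move=> c /gen[a ha]; exists (\row_i a i); rewrite hth.
  by under eq_bigr do rewrite mxE.
Qed.

(** Since [J/(x)] is a direct summand of the first syzygy of [I/(x)] over
    [R/(x)], vanishing for [I/(x)] descends to [J/(x)]. *)
Lemma fiber_descend j : (n <= j)%N ->
  ext_vanish E j.+1 (al : R^o -> Prop) (I : R^o -> Prop) ->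
  ext_vanish E j (al : R^o -> Prop) (J : R^o -> Prop).
Proof.
move=> nj hI; have [k [y [yI gen ymin]]] := fiber_cover.
have [theta hth] := row_map (y : 'I_k.+1 -> R^o).
pose Z u := al (theta u).
have sZ : submod Z.
  split; first by rewrite /Z linear0; apply: (submod0 sal).
  by move=> c u v hu hv; rewrite /Z linearP; apply: sal.2.
have Zm z : Z z -> allin m z by rewrite /Z hth; apply: ymin.
have eZ := fiber_relations yI gen hth hI.
have alZ u : allin al u -> Z u.
  move=> hu; rewrite /Z hth; apply: (submod_sum sal) => i.
  by rewrite /GRing.scale /= mulrC; apply: (submodZ _ sal).
have eU := @ext_vanish_allin R E k.+1 j al sal (@koszul_ext_vanish R x n regx E n j (leqnn n) nj).
have hZ := ext_vanish_sub alZ (fun u _ => Logic.I) eU eZ.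
apply/ext_vanish_idealP => e ke de.
have [phi hphi] := fiber_component (i0 := ord0) sZ (fun z hz => Zm z hz ord0) ke.
have dJ c : J c -> Z (c *: delta_mx 0 ord0).
  move=> hc; rewrite /Z linearZ /= hth (sum_delta (y : 'I_k.+1 -> R^o)).
  exact: fiber_mul.
have [||psi [psiU psiZ]] := hZ phi.
- move=> u hu; rewrite (hphi u 0) ?scale0r //; first exact: alZ.
    exact: (submod0 sJ).
  by rewrite subr0; apply: (fib_aI fIJ).
- move=> z hz; have /(fib_m (fiber_ideals_sym fIJ))[c hc hi] := Zm z hz ord0.
  by rewrite (hphi z c) // linearZ /= de.
exists (psi (delta_mx 0 ord0)); split=> [c hc|c hc].
  rewrite -linearZ /= psiU // => i; rewrite !mxE.
  by case: (_ && _); rewrite ?mulr1 ?mulr0 //; apply: (submod0 sal).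
rewrite -(hphi (c *: delta_mx 0 ord0)) //; last 2 first.
- exact: dJ.
- by rewrite !mxE !eqxx mulr1 subrr; apply: (submod0 sI).
by rewrite psiZ ?linearZ //=; apply: dJ.
Qed.

(** [I/(x)] is principal, generated by an element with annihilator [J/(x)]:
    a cocycle on the relations extends to the free cover, and a Koszul relation
    between two generators would make one of them redundant. *)
Lemma fiber_principal : ext_vanish E n (al : R^o -> Prop) (I : R^o -> Prop) ->
  exists a, [/\ I a, forall c, I c -> exists b, al (c - b * a) & forall c, al (c * a) -> J c].
Proof.
move=> hI; have [k [y [yI gen ymin]]] := fiber_cover.
have [theta hth] := row_map (y : 'I_k.+1 -> R^o).
pose Z u := al (theta u).
have sZ : submod Z.
  split; first by rewrite /Z linear0; apply: (submod0 sal).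
  by move=> c u v hu hv; rewrite /Z linearP; apply: sal.2.
have Zm z : Z z -> allin m z by rewrite /Z hth; apply: ymin.
have eZ := fiber_relations yI gen hth hI.
have alZ u : allin al u -> Z u.
  move=> hu; rewrite /Z hth; apply: (submod_sum sal) => i.
  by rewrite /GRing.scale /= mulrC; apply: (submodZ _ sal).
have thd i : theta (delta_mx 0 i) = y i.
  by rewrite hth (sum_delta (y : 'I_k.+1 -> R^o)).
have [e [ke de gene faith]] := @koszul_generator R x n regx E n (leqnn n).
have [phi hphi] := fiber_component (i0 := ord0) sZ (fun z hz => Zm z hz ord0) ke.
have phi0 z : Z z -> I (z 0 ord0) -> phi z = 0.
  by move=> hz hi; rewrite (hphi z 0) ?scale0r ?subr0 //; apply: (submod0 sJ).
have [||psi [psiZ hpsi]] := eZ (d \o phi : {linear _ -> _}).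
- move=> z hz /=; have /(fib_m (fiber_ideals_sym fIJ))[c hc hi] := Zm z hz ord0.
  by rewrite (hphi z c) // linearZ /= de scaler0.
- by move=> z _ /=; apply: ir_dd.
pose g : {linear 'rV[R]_k.+1 -> E n} := phi \- psi.
have gE z : Z z -> g z = phi z by move=> hz; rewrite /g /= psiZ // subr0.
have /choice[c hc] : forall i, exists c, coboundary al (g (delta_mx 0 i) - c *: e).
  move=> i; apply: gene.
    move=> c hc.
    have hcd : allin al (c *: delta_mx 0 i : 'rV[R]_k.+1).
      move=> l; rewrite !mxE.
      by case: (_ && _); rewrite ?mulr1 ?mulr0 //; apply: (submod0 sal).
    have hz := alZ _ hcd; rewrite -linearZ gE // phi0 //.
    exact: fib_aI fIJ _ (hcd ord0).
  by rewrite /g linearB /= -hpsi //= subrr.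
have sumc z : coboundary al (g z - (\sum_i z 0 i * c i) *: e).
  rewrite row_mapE scaler_suml -sumrB; apply: submod_sum; first exact: submod_coboundary.
  move=> i; rewrite -scalerA -scalerBr; apply: submodZ => //; exact: submod_coboundary.
have relc z : Z z -> I (z 0 ord0) -> al (\sum_i z 0 i * c i).
  move=> hz hi; apply: faith; have := sumc z; rewrite gE // phi0 // sub0r => h.
  rewrite -[_ *: e]opprK; apply: submodN => //; exact: submod_coboundary.
have dJ b : J b -> Z (b *: delta_mx 0 ord0).
  by move=> hb; rewrite /Z linearZ /= thd; apply: fiber_mul.
have dsum (f : 'I_k.+1 -> R) b i : \sum_l (b *: delta_mx 0 i : 'rV[R]_k.+1) 0 l * f l = b * f i.
  rewrite -[in RHS](sum_delta (f : 'I_k.+1 -> R^o) i) mulr_sumr; apply: eq_bigr => l _.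
  by rewrite mxE -mulrA.
have c0_unit : ~ m (c ord0).
  move=> mc; have [j Jj] := fib_J fIJ; apply.
  have [b hb] : exists b, b * (1 - c ord0) = 1.
    by apply: m_unit => /(maxD sm mc); rewrite addrC subrK.
  have hj : al (j * c ord0 - j).
    have hz := dJ _ Jj; apply: faith; have := sumc (j *: delta_mx 0 ord0).
    rewrite dsum gE // (hphi _ j) //; last first.
      by rewrite !mxE !eqxx mulr1 subrr; apply: (submod0 sI).
    rewrite -scalerBl => h; rewrite -opprB scaleNr; apply: submodN => //.
    exact: submod_coboundary.
  have -> : j = (- b) * (j * c ord0 - j) by rewrite mulNr -mulrN opprB -{2}[j]mulr1 -mulrBr mulrCA hb mulr1.
  exact: (submodZ _ sal).
have one i1 : i1 = ord0 :> 'I_k.+1.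
  apply: contrapT => /eqP ni; apply: c0_unit.
  (* The Koszul relation between the generators of indices 0 and i1. *)
  pose z : 'rV[R]_k.+1 := y i1 *: delta_mx 0 ord0 + (- y ord0) *: delta_mx 0 i1.
  have zsum f : \sum_i z 0 i * f i = y i1 * f ord0 - y ord0 * f i1.
    by rewrite /z; under eq_bigr do rewrite mxE mulrDl; rewrite big_split /= !dsum mulNr.
  have hz : Z z.
    rewrite /Z hth -[X in al X]/(\sum_i z 0 i * y i) zsum mulrC subrr; exact: (submod0 sal).
  have hi0 : I (z 0 ord0).
    by rewrite /z !mxE /= [ord0 == _]eq_sym (negbTE ni) mulr1 mulr0 addr0.
  have := relc _ hz hi0; rewrite zsum => h.
  pose z' : 'rV[R]_k.+1 := c ord0 *: delta_mx 0 i1 + (- c i1) *: delta_mx 0 ord0.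
  have -> : c ord0 = z' 0 i1 by rewrite /z' !mxE /= eqxx (negbTE ni) mulr1 mulr0 addr0.
  apply: ymin; rewrite /z'; under eq_bigr do rewrite mxE mulrDl.
  by rewrite big_split /= !dsum mulNr mulrC [c i1 * _]mulrC.
exists (y ord0); split=> // [b /gen[a ha]|b hb].
  exists (a ord0); rewrite (bigD1 ord0) //= big1 ?addr0 // in ha.
  by move=> i; rewrite (one i) eqxx.
have hZb : Z (b *: delta_mx 0 ord0) by rewrite /Z linearZ /= thd.
have := Zm _ hZb ord0; rewrite !mxE !eqxx mulr1 => /(fib_m fIJ)[i hi hj].
have hZi : Z (i *: delta_mx 0 ord0).
  rewrite /Z linearZ /= thd.
  have -> : i *: (y ord0 : R^o) = b * y ord0 - (b - i) * y ord0 by rewrite /GRing.scale /=; ring.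
  by apply: (submodB sal) => //; apply: fiber_mul.
have := relc _ hZi; rewrite dsum !mxE !eqxx mulr1 => /(_ hi) hic.
have [u hu] := m_unit c0_unit.
have ali : al i.
  have -> : i = u * (i * c ord0) by rewrite mulrCA hu mulr1.
  exact: (submodZ _ sal).
by rewrite -(subrK i b); apply: (submodD sJ) => //; apply: (fib_aJ fIJ).
Qed.

End Fixed.

Variable D : nat.
Hypothesis E_bound : forall i, (D < i)%N -> forall z : E i, z = 0.

Lemma ext_vanish_large (F : lmodType R) (U V : F -> Prop) j :
  (D <= j)%N -> ext_vanish E j U V.
Proof.
move=> Dj phi _ _; exists (GRing.null_fun _ : {linear F -> E j}); split=> // v _ /=.
by rewrite linear0; apply: E_bound.
Qed.

Lemma fiber_vanish I J : fiber_ideals I J -> forall j, (n <= j)%N ->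
  ext_vanish E j (al : R^o -> Prop) (I : R^o -> Prop).
Proof.
move=> fIJ j nj; have [k hk] := ubnP (D - j); move: I J fIJ j nj hk.
elim: k => // k ih I J fIJ j nj; rewrite ltnS => hk.
case: (leqP D j) => [|jD]; first exact: ext_vanish_large.
apply: (@fiber_descend J I (fiber_ideals_sym fIJ)) => //.
apply: (ih J I (fiber_ideals_sym fIJ)); first exact: leqW.
by rewrite subnS prednK ?subn_gt0.
Qed.

(** Ext^j(k, R) = 0 for j > n + 1. *)
Lemma residue_vanish I J : fiber_ideals I J -> forall j, (n < j)%N ->
  ext_vanish E j (m : R^o -> Prop) (fun _ : R^o => True).
Proof.
move=> fIJ [//|j] nj.
have sI := fib_sI fIJ; have sJ := fib_sJ fIJ.
have alm c : al c -> m c by move=> /(fib_aI fIJ); exact: (fiber_mI fIJ).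
apply: (@ext_vanish_quo _ E R^o al m _ alm (fun _ _ => Logic.I)); last first.
  exact: (@koszul_ext_vanish R x n regx E n j.+1 (leqnn n) (leqW nj)).
have /ext_vanish_idealP hI := fiber_vanish fIJ nj.
have /ext_vanish_idealP hJ := fiber_vanish (fiber_ideals_sym fIJ) nj.
apply/ext_vanish_idealP => e ke de.
have [//||e1 [k1 he1]] := hI e.
  by move=> c hc; apply: de; exact: (fiber_mI fIJ).
have [//||e2 [k2 he2]] := hJ e.
  by move=> c hc; apply: de; exact: (fiber_mJ fIJ).
have /choice[r hr] : forall c, exists i, m c -> I i /\ J (c - i).
  move=> c; case: (pselect (m c)) => [/(fib_m fIJ)[i hi hj]|hc]; by [exists i | exists 0].
have rE c i : m c -> I i -> J (c - i) -> r c *: e1 + (c - r c) *: e2 = i *: e1 + (c - i) *: e2.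
  move=> hc hi hj; have [hi' hj'] := hr c hc; apply/eqP.
  rewrite -subr_eq0 opprD addrACA -!scalerBl.
  have hri : al (r c - i).
    apply: (fib_IJ fIJ); first exact: (submodB sI).
    have -> : r c - i = (c - i) - (c - r c) by ring.
    exact: (submodB sJ).
  rewrite k1 //.
  have -> : c - r c - (c - i) = - (r c - i) by ring.
  by rewrite scaleNr k2 // subr0.
have [|psi hpsi] := @injective_extend R (E j) R^o m (fun c => r c *: e1 + (c - r c) *: e2)
  (@ir_injective _ _ E _) sm.
  move=> c u v hu hv; have [iu ju] := hr u hu; have [iv jv] := hr v hv.
  rewrite (rE _ (c * r u + r v)).
  - have -> : c *: u + v - (c * r u + r v) = c * (u - r u) + (v - r v).
      by rewrite /GRing.scale /=; ring.
    by rewrite scalerDr !scalerA !scalerDl addrACA.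
  - exact: sm.2.
  - exact: sI.2.
  - have -> : c *: u + v - (c * r u + r v) = c * (u - r u) + (v - r v).
      by rewrite /GRing.scale /=; ring.
    exact: sJ.2.
have psiE c : psi c = c *: psi 1 by rewrite -linearZ /= [_ *: _]mulr1.
exists (psi 1); split=> [c hc|c hc].
  have hm := alm c hc; have hi := fib_aI fIJ hc; rewrite -psiE hpsi // (rE c c) //.
    by rewrite subrr scale0r addr0 k1.
  by rewrite subrr; apply: (submod0 sJ).
have [hi hj] := hr c hc.
rewrite -[in RHS]linearZ /= -psiE hpsi // linearD !linearZ /= -he1 // -he2 //.
by rewrite -scalerDl addrC subrK.
Qed.

End FiberIdeals.

(** * Vanishing of Ext(-, R) above the bound given by the residue field *)

Section Bass.
Variables (R : comNzRingType) (m : R -> Prop).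
Hypothesis sm : submod (m : R^o -> Prop).
Hypothesis m_proper : ~ m 1.
Hypothesis m_unit : forall c, ~ m c -> exists d, d * c = 1.
Hypothesis nR : ideals_fgen R.
Variable E : injective_resolution (R^o : lmodType R).
Local Notation d := (ir_d E _).

(** Coboundaries of Hom(F/V, E). *)
Definition map_coboundary (F : lmodType R) (V : F -> Prop) (l : nat) : (F -> E l) -> Prop :=
  match l with
  | 0 => fun f => forall u, f u = 0
  | l'.+1 => fun f => exists psi : {linear F -> E l'},
      (forall v, V v -> psi v = 0) /\ forall u, f u = d (psi u)
  end.

(** Ext^j(F/V, R) is finitely generated when [F] is free of finite rank. *)
Lemma ext_fgen j r (V : 'rV[R]_r -> Prop) : submod V ->
  exists k (f : 'I_k -> {linear 'rV[R]_r -> E j}),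
    (forall i, (forall v, V v -> f i v = 0) /\ forall u, d (f i u) = 0) /\
    forall phi : {linear 'rV[R]_r -> E j},
      (forall v, V v -> phi v = 0) -> (forall u, d (phi u) = 0) ->
      exists c : 'I_k -> R, map_coboundary V (fun u => phi u - \sum_i c i *: f i u).
Proof.
elim: j r V => [|j ih] r V sV.
  pose H (w : 'rV[R]_r) := forall u, V u -> \sum_i u 0 i * w 0 i = 0.
  have sH : submod H.
    split; first by move=> u _; rewrite big1 // => i _; rewrite mxE mulr0.
    move=> c w w' hw hw' u hu.
    under eq_bigr do rewrite !mxE mulrDr mulrCA.
    by rewrite big_split /= -mulr_sumr hw // hw' // mulr0 addr0.
  have /fgenE[k [w [Hw gen]]] := fgen_submod nR sH (fun u _ => row_span u Logic.I).
  have augE c : ir_aug E c = c *: ir_aug E 1 by rewrite -linearZ /= [_ *: _]mulr1.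
  have augS (w' u : 'rV[R]_r) : \sum_i u 0 i *: ir_aug E (w' 0 i)
      = ir_aug E (\sum_i u 0 i * w' 0 i).
    by rewrite linear_sum; apply: eq_bigr => i _; rewrite -linearZ.
  have /choice[f hf] : forall l : 'I_k, exists f : {linear 'rV[R]_r -> E 0%N},
      forall u, f u = ir_aug E (\sum_i u 0 i * w l 0 i).
    move=> l; have [f hf] := row_map (fun i => ir_aug E (w l 0 i)).
    by exists f => u; rewrite hf augS.
  exists k, f; split.
    move=> l; split=> [v hv|u]; first by rewrite hf Hw // linear0.
    by rewrite hf; apply/ir_exact0; exists (\sum_i u 0 i * w l 0 i).
  move=> phi phiV dphi.
  have /choice[h hh] : forall i, exists c, ir_aug E c = phi (delta_mx 0 i).
    by move=> i; apply/ir_exact0; apply: dphi.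
  pose w0 : 'rV[R]_r := \row_i h i.
  have phiE u : phi u = ir_aug E (\sum_i u 0 i * w0 0 i).
    by rewrite row_mapE -augS; apply: eq_bigr => i _; rewrite mxE hh.
  have /gen[c hc] : H w0.
    by move=> u hu; apply: (@ir_aug_inj _ _ E); rewrite -phiE phiV // linear0.
  exists c => u; apply/eqP; rewrite subr_eq0; apply/eqP.
  under [RHS]eq_bigr do rewrite hf -linearZ /=.
  rewrite -linear_sum phiE hc; congr (ir_aug E _).
  under [RHS]eq_bigr do rewrite /GRing.scale /= mulr_sumr.
  rewrite exchange_big /=; apply: eq_bigr => i _.
  by rewrite summxE mulr_sumr; apply: eq_bigr => l _; rewrite !mxE mulrCA.
have /fgenE[p [v [Vv genV]]] := fgen_submod nR sV (fun u _ => row_span u Logic.I).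
have [theta hth] := row_map v.
pose V' u := theta u = 0.
have sV' : submod V'.
  split; first exact: linear0.
  by move=> c u w hu hw; rewrite /V' linearP hu hw scaler0 addr0.
have thV u : V (theta u).
  by rewrite hth; apply: submod_sum => // i; apply: submodZ.
have Vth w : V w -> exists u, w = theta u.
  by move=> /genV[c ->]; exists (\row_i c i); rewrite hth; apply: eq_bigr => i _; rewrite mxE.
(* Maps defined on [V], seen as maps from the cover killing its kernel, extend. *)
have ext i (g : {linear 'rV[R]_p -> E i}) : (forall u, V' u -> g u = 0) ->
    exists g' : {linear 'rV[R]_r -> E i}, forall u, g' (theta u) = g u.
  move=> hg.
  have /choice[s hs] : forall w, exists u, V w -> w = theta u.
    by move=> w; case: (pselect (V w)) => [/Vth[u ->]|hw]; [exists u | exists 0].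
  have sE w u : V w -> w = theta u -> g (s w) = g u.
    move=> hw hu; apply/eqP; rewrite -subr_eq0 -linearB hg //.
    by rewrite /V' linearB /= -hs // hu subrr.
  have [|g' hg'] := @injective_extend R (E i) _ V (fun w => g (s w)) (@ir_injective _ _ E _) sV.
    move=> c u w hu hw; rewrite -linearP; apply: sE; first exact: sV.2.
    by rewrite linearP /= -!hs.
  by exists g' => u; rewrite hg' //; apply: sE.
have lift i (f : 'rV[R]_p -> E i) : map_coboundary V' f ->
    exists g : {linear 'rV[R]_r -> E i}, (forall u, d (g u) = 0) /\ forall u, g (theta u) = f u.
  case: i f => [|i] f /=.
    by move=> hf; exists (GRing.null_fun _ : {linear _ -> _}); split=> u; rewrite ?hf ?linear0.
  move=> [psi [/ext[psi' hpsi'] hpsi]]; exists (d \o psi' : {linear _ -> _}).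
  by split=> u /=; rewrite ?ir_dd // hpsi' hpsi.
have [k [f [hf genf]]] := ih p V' sV'.
have /choice[f' hf'] : forall i, exists f' : {linear 'rV[R]_r -> E j},
    forall u, f' (theta u) = f i u by move=> i; apply: ext; apply: (hf i).1.
exists k, (fun i => (d \o f' i : {linear _ -> _})); split.
  move=> i; split=> [w /Vth[u ->] /=|u /=]; first by rewrite hf' (hf i).2.
  exact: ir_dd.
move=> phi phiV dphi.
have [chi [_ hchi]] : exists chi : {linear 'rV[R]_r -> E j},
    (forall u, u = 0 -> chi u = 0) /\ forall u, True -> phi u = d (chi u).
  by apply: ext_vanish_free => [u ->|u _]; [apply: linear0 | apply: dphi].
have [||c hc] := genf (chi \o theta : {linear _ -> _}).
- by move=> u hu /=; rewrite hu linear0.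
- by move=> u /=; rewrite -hchi // phiV.
exists c.
have [chi' hchi'] : exists chi' : {linear 'rV[R]_r -> E j},
    forall u, chi' u = chi u - \sum_i c i *: f' i u.
  apply: linear_map_exists => a u w; rewrite linearP scalerBr scaler_sumr addrACA -opprD -big_split /=.
  congr (_ - _); apply: eq_bigr => i _.
  by rewrite linearP scalerDr !scalerA mulrC.
have dsum u : \sum_i c i *: (d \o f' i : {linear _ -> _}) u = d (\sum_i c i *: f' i u).
  by rewrite linear_sum; apply: eq_bigr => i _; rewrite linearZ.
have chi'th u : chi' (theta u) = chi (theta u) - \sum_i c i *: f i u.
  by rewrite hchi'; under eq_bigr do rewrite hf'.
have [g [dg hg]] := lift _ _ hc.
exists (chi' \- g : {linear _ -> _}); split=> [w /Vth[u ->]|u] /=.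
  by rewrite chi'th hg subrr.
by rewrite dsum hchi // linearB /= dg subr0 hchi' linearB.
Qed.

(** Ext^j(R/b, R) is finitely generated, stated for elements of [E]. *)
Lemma ext_cyclic_fgen j (b : R -> Prop) : submod (b : R^o -> Prop) ->
  fgen_mod (@coboundary R E b j) (fun e : E j => killed b e /\ d e = 0).
Proof.
move=> sb; pose V (u : 'rV[R]_1) := allin b u.
have [k [f [hf genf]]] := @ext_fgen j 1 V (submod_allin 1 sb).
pose one : 'rV[R]_1 := delta_mx 0 ord0.
have Vone c : b c -> V (c *: one).
  by move=> hc i; rewrite !ord1 !mxE !eqxx mulr1.
have rowE i (phi : {linear 'rV[R]_1 -> E i}) u : phi u = u 0 ord0 *: phi one.
  by rewrite row_mapE big_ord1.
exists k, (fun i => f i one); split=> [i|e [ke de]].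
  split; last exact: (hf i).2.
  by move=> c hc; rewrite -linearZ /= (hf i).1 //; apply: Vone.
have [phi hphi] := row_map (fun _ : 'I_1 => e).
have phiE u : phi u = u 0 ord0 *: e by rewrite hphi big_ord1.
have [||c hc] := genf phi.
- by move=> u hu; rewrite phiE ke.
- by move=> u; rewrite phiE linearZ /= de scaler0.
exists (\sum_i c i *: f i one); first by exists c.
have phi1 : phi one = e by rewrite phiE mxE !eqxx scale1r.
case: j e ke de f hf genf phi hphi phiE hc phi1 => [|j] e ke de f hf genf phi hphi phiE hc phi1 /=.
  by rewrite -[X in X - _]phi1; apply: hc.
have [psi [psiV hpsi]] := hc; exists (psi one); last by rewrite -hpsi phi1.
by move=> a ha; rewrite -linearZ /= psiV //; apply: Vone.
Qed.

(** Vanishing on cyclic modules extends to finitely generated ones. *)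
Lemma ext_vanish_fg j (F : lmodType R) k (g : 'I_k -> F) (V W : F -> Prop) :
  (forall b, submod (b : R^o -> Prop) -> ext_vanish E j (b : R^o -> Prop) (fun _ : R^o => True)) ->
  submod V -> submod W -> (forall u, V u -> W u) -> (forall i, W (g i)) ->
  (forall w, W w -> addS (span g) V w) -> ext_vanish E j V W.
Proof.
move=> cyc; elim: k g V => [|k ih] g V sV sW VW Wg gen.
  have WV w : W w -> V w by move=> /gen[u [c ->]]; rewrite big_ord0 subr0.
  move=> phi phiV _; exists (GRing.null_fun _ : {linear F -> E j}); split=> // w /WV hw /=.
  by rewrite phiV // linear0.
pose G u := exists c, u = c *: g ord0.
have sG : submod G.
  split; first by exists 0; rewrite scale0r.
  by move=> c u v [a ->] [b ->]; exists (c * a + b); rewrite scalerDl scalerA.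
have V1W u : addS G V u -> W u.
  move=> [v [c ->] hv]; rewrite -(subrK (c *: g ord0) u).
  by apply: submodD => //; [apply: VW | apply: submodZ].
apply: (ext_vanish_mid (V := addS G V)) => //.
- by move=> u hu; apply: addSr.
- apply: ext_vanish_cyclic => //; apply: cyc; split.
    by rewrite scale0r; apply: submod0.
  by move=> c u v hu hv; rewrite scalerDl -scalerA; apply: sV.2.
apply: (ih (fun i => g (lift ord0 i))) => //; first exact: submod_add.
move=> w /gen[u [c ->]]; rewrite big_ord_recl => h.
exists (\sum_i c (lift ord0 i) *: g (lift ord0 i)); first by exists (fun i => c (lift ord0 i)).
exists (c ord0 *: g ord0); first by exists (c ord0).
by move: h; congr V; zmod.
Qed.

(** If Ext^(j+1) vanishes on the residue field and Ext^(j+2) vanishes on all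
    cyclic modules, then Ext^(j+1) vanishes on all cyclic modules. *)
Lemma ext_vanish_cyclic_step j :
  ext_vanish E j (m : R^o -> Prop) (fun _ : R^o => True) ->
  (forall b, submod (b : R^o -> Prop) -> ext_vanish E j.+1 (b : R^o -> Prop) (fun _ : R^o => True)) ->
  forall b, submod (b : R^o -> Prop) -> ext_vanish E j (b : R^o -> Prop) (fun _ : R^o => True).
Proof.
move=> hm hS; apply: (ideal_ind nR) => b sb ih.
case: (pselect (exists y z, [/\ ~ b y, ~ b z & b (y * z)])) => [[y [z [by_ bz byz]]]|prime].
  have sG : submod (fun u : R^o => exists c, u = c *: (z : R^o)).
    split; first by exists 0; rewrite scale0r.
    by move=> c u v [a ->] [a' ->]; exists (c * a + a'); rewrite scalerDl scalerA.
  apply: (ext_vanish_mid (V := addS (fun u : R^o => exists c, u = c *: (z : R^o)) b)) => //.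
  - by move=> u hu; apply: (addSr sG).
  - apply: ext_vanish_cyclic => //; apply: ih.
    + split; first by rewrite scale0r; apply: (submod0 sb).
      by move=> c u v hu hv; rewrite scalerDl -scalerA; apply: sb.2.
    + by move=> c hc; rewrite /GRing.scale /= mulrC; apply: (submodZ _ sb).
    + by exists y.
  - apply: ih; first exact: (submod_add sG sb).
    + by move=> u hu; apply: (addSr sG).
    + by exists z => //; apply: (addSl sb); exists 1; rewrite scale1r.
case: (pselect (exists2 y, m y & ~ b y)) => [[y my nby]|mb].
  (* [b] is prime, so that [y] is a nonzerodivisor modulo [b]. *)
  have regy c : b (y * c) -> b c.
    by move=> h; apply: contrapT => nc; apply: prime; exists y, c.
  have sG : submod (fun u : R^o => exists c, u = c *: (y : R^o)).
    split; first by exists 0; rewrite scale0r.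
    by move=> c u v [a ->] [a' ->]; exists (c * a + a'); rewrite scalerDl scalerA.
  pose b' : R -> Prop := addS (fun u : R^o => exists c, u = c *: (y : R^o)) b.
  have sb' : submod (b' : R^o -> Prop) by apply: submod_add.
  have bb' c : b c -> b' c by move=> hc; apply: (addSr sG).
  have by' : b' y by apply: (addSl sb); exists 1; rewrite scale1r.
  (* Every cocycle is [y] times a cocycle. *)
  have div (e : E j.+1) : killed b e -> d e = 0 ->
      exists e' : E j.+1, [/\ killed b e', d e' = 0 & y *: e' = e].
    move=> ke de; have [e1 k1 he1] := killed_divisible sb regy ke.
    have /ext_vanish_idealP h := hS b' sb'.
    have [||e2 [k2 he2]] := h (d e1).
    - move=> c [u [a ->] hc]; rewrite -(subrK (a *: (y : R^o)) c) scalerDl.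
      rewrite (killed_lin _ k1) // add0r -[a *: (y : R^o)]/(a * y) -scalerA.
      by rewrite -[y *: _]linearZ /= he1 de scaler0.
    - by move=> c _; rewrite ir_dd scaler0.
    exists (e1 - e2); split.
    - apply: (submodB (@submod_killed _ _ _)) => // c hc; apply: k2; exact: bb'.
    - by have := he2 1 Logic.I; rewrite !scale1r linearB /= => ->; rewrite subrr.
    - by rewrite scalerBr he1 (k2 y by') subr0.
  have nak := @nakayama R m sm m_proper m_unit (E j.+1) _ _ (@submod_coboundary R E b j.+1) (@ext_cyclic_fgen j.+1 b sb).
  apply/ext_vanish_idealP => e ke de.
  have [e' k' he'] : @coboundary R E b j.+1 e.
    apply: nak; last first.
      by split=> //; have := de 1 Logic.I; rewrite scale1r.
    move=> w [kw dw]; have [w' [kw' dw' <-]] := div w kw dw.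
    apply: addSr; first exact: submod_coboundary.
    exact: prodS1.
  by exists e'; split=> // c _; rewrite he'.
have mb' c : m c -> b c by move=> hc; apply: contrapT => nc; apply: mb; exists c.
case: (pselect (b 1)) => [b1|nb1].
  move=> phi phib _; exists (GRing.null_fun _ : {linear R^o -> E j}); split=> // w _ /=.
  rewrite linear0 phib // -[w]mulr1; exact: (submodZ _ sb).
suff -> : b = m by [].
apply/funext => c; apply/propext; split=> [hc|/mb' //].
apply: contrapT => /m_unit[u hu]; apply: nb1; rewrite -hu; exact: (submodZ _ sb).
Qed.

Variables (D s : nat).
Hypothesis E_bound : forall i, (D < i)%N -> forall z : E i, z = 0.
Hypothesis residue : forall j, (s <= j)%N ->
  ext_vanish E j (m : R^o -> Prop) (fun _ : R^o => True).

(** If Ext^(j+1)(k, R) = 0 for all j >= s, the same holds for all finitely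
    generated modules [F/V], by descending induction from the length [D] of the
    injective resolution. *)
Lemma ext_vanish_bound (F : lmodType R) k (g : 'I_k -> F) (V : F -> Prop) j :
  (s <= j)%N -> submod V -> (forall u, span g u) -> ext_vanish E j V (fun=> True).
Proof.
move=> sj sV hg; apply: (@ext_vanish_fg j F k g) => //; last first.
  by move=> w _; apply: addSl.
have [p hp] := ubnP (D - j).
elim: p j sj hp => // p ih j sj; rewrite ltnS => hp.
case: (leqP D j) => [Dj b sb|jD]; first exact: (@ext_vanish_large R E D E_bound).
apply: ext_vanish_cyclic_step; first exact: residue.
apply: ih; first exact: leqW.
by rewrite subnS prednK ?subn_gt0.
Qed.

End Bass.

(** * Syzygies modulo the regular sequence *)

Section RowMatrices.
Variable R : comNzRingType.

Lemma allin_mul k l (P : R -> Prop) (u : 'rV[R]_k) (B : 'M[R]_(k, l)) :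
  submod (P : R^o -> Prop) -> allin P u -> allin P (u *m B).
Proof.
move=> sP hu i; rewrite mxE; apply: (submod_sum sP) => j.
by rewrite mulrC; apply: (submodZ _ sP).
Qed.

Lemma allin_sum k p (P Q S : R -> Prop) (c : 'I_p -> R) (v : 'I_p -> 'rV[R]_k) :
  submod (S : R^o -> Prop) -> (forall a b, P a -> Q b -> S (a * b)) ->
  (forall i, P (c i)) -> (forall i, allin Q (v i)) -> allin S (\sum_i c i *: v i).
Proof.
move=> sS hPQ hc hv l; rewrite summxE; apply: (submod_sum sS) => i.
by rewrite mxE; apply: hPQ => //; apply: hv.
Qed.

Lemma allin_split k (P Q S : R -> Prop) (u : 'rV[R]_k) :
  (forall c, S c -> exists2 p, P p & Q (c - p)) -> allin S u ->
  exists2 v, allin P v & allin Q (u - v).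
Proof.
move=> hS hu; have /choice[p hp] : forall i, exists p, P p /\ Q (u 0 i - p).
  by move=> i; have [p ? ?] := hS _ (hu i); exists p.
by exists (\row_i p i) => i; rewrite !mxE; case: (hp i).
Qed.

Lemma submod_ker (F F' : lmodType R) (f : {linear F -> F'}) : submod (fun u => f u = 0).
Proof.
split; first exact: linear0.
by move=> c u v hu hv; rewrite linearP hu hv scaler0 addr0.
Qed.

Lemma submod_kerM k l (B : 'M[R]_(k, l)) : submod (fun u : 'rV[R]_k => u *m B = 0).
Proof. exact: (submod_ker (mulmxr B)). Qed.

Lemma submod_imM k l (B : 'M[R]_(k, l)) : submod (fun u : 'rV[R]_l => exists w, u = w *m B).
Proof.
split; first by exists 0; rewrite mul0mx.
by move=> c u v [a ->] [b ->]; exists (c *: a + b); rewrite mulmxDl scalemxAl.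
Qed.

Lemma mul_rows k l (u : 'rV[R]_k) (v : 'I_k -> 'rV[R]_l) :
  u *m (\matrix_i v i) = \sum_i u 0 i *: v i.
Proof. by rewrite mulmx_sum_row; apply: eq_bigr => i _; rewrite rowK. Qed.

(** Matrices act on row vectors from the right: the kernel of [B] is the image
    of [B']. *)
Definition exact_at k l p (B' : 'M[R]_(p, l)) (B : 'M[R]_(l, k)) : Prop :=
  forall u : 'rV[R]_l, u *m B = 0 <-> exists w, u = w *m B'.

End RowMatrices.

Section Syzygies.
Variables (R : comNzRingType) (m : R -> Prop).
Hypothesis sm : submod (m : R^o -> Prop).
Hypothesis m_proper : ~ m 1.
Hypothesis m_unit : forall c, ~ m c -> exists d, d * c = 1.
Hypothesis nR : ideals_fgen R.
Variables (x : nat -> R) (n : nat).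
Hypothesis regx : forall l, (l < n)%N -> forall c, seq_ideal x l (x l * c) -> seq_ideal x l c.
Local Notation al := (seq_ideal x n).
Hypothesis al_m : forall c, al c -> m c.

Lemma allin_seqS k l (u : 'rV[R]_k) :
  allin (seq_ideal x l.+1) u <-> exists w, allin (seq_ideal x l) (u - x l *: w).
Proof.
split=> [hu|[w hw] i]; last by exists (w 0 i); have := hw i; rewrite !mxE mulrC.
have /choice[w hw] := hu; exists (\row_i w i) => i.
by rewrite !mxE mulrC; apply: hw.
Qed.

(** Tor_1(C, R/(x_0,..,x_(l-1))) = 0 for the cokernel C of [B]: a vector mapped
    to zero modulo the ideal comes, modulo the ideal, from the kernel of [B]. *)
Definition tor_ok l k p (B : 'M[R]_(k, p)) : Prop :=
  forall u : 'rV[R]_k, allin (seq_ideal x l) (u *m B) ->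
  exists2 v, v *m B = 0 & allin (seq_ideal x l) (u - v).

Lemma tor_ok0 k p (B : 'M[R]_(k, p)) : tor_ok 0 B.
Proof.
move=> u hu; exists u; last by move=> i; rewrite !mxE subrr.
by apply/rowP => i; rewrite (hu i) mxE.
Qed.

Lemma tor_okS l k p q (B : 'M[R]_(k, p)) (B' : 'M[R]_(q, k)) : (l < n)%N ->
  exact_at B' B -> tor_ok l B -> tor_ok l B' -> tor_ok l.+1 B'.
Proof.
move=> ln ex tB tB' u /allin_seqS[w hw]; have sl := submod_seq_ideal x l.
have hB : allin (seq_ideal x l) (w *m B).
  move=> i; apply: (regx ln).
  have : allin (seq_ideal x l) ((u *m B' - x l *: w) *m B) by apply: allin_mul.
  have -> : (u *m B' - x l *: w) *m B = - (x l *: (w *m B)).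
    rewrite mulmxBl; have -> : u *m B' *m B = 0 by apply/ex; exists u.
    by rewrite sub0r scalemxAl.
  by move=> /(_ i); rewrite !mxE => /(submodN sl) /=; rewrite opprK.
have [v /ex[v' ->] hv] := tB w hB.
have [|v'' hv'' h] := tB' (u - x l *: v').
  rewrite mulmxBl -scalemxAl.
  have -> : u *m B' - x l *: (v' *m B') = (u *m B' - x l *: w) + x l *: (w - v' *m B').
    by rewrite scalerBr; zmod.
  by apply: (submodD (submod_allin _ sl)) => //; apply: (submodZ _ (submod_allin _ sl)).
exists v'' => //; apply/allin_seqS; exists v'.
by have -> : u - v'' - x l *: v' = u - x l *: v' - v'' by zmod.
Qed.

(** The Tor_1 of the image of [B] vanishes too, so that the kernel of [B] meets
    the multiples of [(x)] in its own multiples; weakened here from [(x)] to [m]. *)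
Lemma tor_ok_ker k p (B : 'M[R]_(k, p)) : (forall l, (l < n)%N -> tor_ok l B) ->
  forall u, u *m B = 0 -> allin al u -> prodS m (fun v : 'rV[R]_k => v *m B = 0) u.
Proof.
move=> tB; have : (n <= n)%N by [].
move: {1 3}n => l; elim: l => [|l ih] ln u uB hu.
  have -> : u = 0 by apply/rowP => i; rewrite (hu i) mxE.
  exact: prodS0.
have [w hw] := (allin_seqS l u).1 hu; have sl := submod_seq_ideal x l.
have hB : allin (seq_ideal x l) (w *m B).
  move=> i; apply: (regx ln).
  have : allin (seq_ideal x l) ((u - x l *: w) *m B) by apply: allin_mul.
  rewrite mulmxBl uB sub0r -scalemxAl.
  by move=> /(_ i); rewrite !mxE => /(submodN sl) /=; rewrite opprK.
have [v vB hv] := tB l ln w hB.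
have sP := @submod_prodS R _ m _ (submod_kerM B).
rewrite -(subrK (x l *: v) u); apply: (submodD sP); last first.
  apply: prodS1 => //; apply: al_m; apply: (@seq_ideal_le _ _ l.+1) => //.
  by rewrite -[x l]mul1r; apply: seq_ideal_last.
apply: ih; first exact: ltnW.
  by rewrite mulmxBl uB -scalemxAl vB scaler0 subr0.
have -> : u - x l *: v = (u - x l *: w) + x l *: (w - v) by rewrite scalerBr; zmod.
by apply: (submodD (submod_allin _ sl)) => //; apply: (submodZ _ (submod_allin _ sl)).
Qed.

(** The kernel of [B] lies in the maximal ideal times the free module. *)
Definition minker k p (B : 'M[R]_(k, p)) : Prop := forall u, u *m B = 0 -> allin m u.

(** The next map of a minimal free resolution. *)
Lemma minimal_cover (A : lmodType R) k (f : {linear 'rV[R]_k -> A}) :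
  exists p (B' : 'M[R]_(p, k)), (forall u, f u = 0 <-> exists w, u = w *m B') /\ minker B'.
Proof.
have [p [v [vV gen vmin]]] := minimal_generators m_unit (@submod_zero R _)
  (fgen_submod nR (submod_ker f) (fun u _ => row_span u Logic.I)).
exists p, (\matrix_i v i); split=> [u|c].
  split=> [/gen[w [c ->] /eqP]|[w ->]]; last first.
    by rewrite mul_rows; apply: (submod_sum (submod_ker f)) => i; apply: (submodZ _ (submod_ker f)).
  rewrite subr_eq0 => /eqP ->; exists (\row_i c i); rewrite mul_rows.
  by apply: eq_bigr => i _; rewrite mxE.
by rewrite mul_rows => h i; apply: (vmin (fun i => c 0 i)).
Qed.

(** [m/(x)] is the direct sum of [I/(x)] and [J/(x)], which are generated by
    the classes of [a] and [b], and are each other's annihilator. *)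
Record fiber_generators (I J : R -> Prop) (a b : R) : Prop := FiberGenerators {
  fg_ideals : fiber_ideals m x n I J;
  fg_a : I a; fg_b : J b;
  fg_genI : forall c, I c -> exists t, al (c - t * a);
  fg_genJ : forall c, J c -> exists t, al (c - t * b);
  fg_annI : forall c, al (c * a) -> J c;
  fg_annJ : forall c, al (c * b) -> I c }.

Lemma fiber_generators_sym I J a b : fiber_generators I J a b -> fiber_generators J I b a.
Proof. by case=> *; split=> //; apply: fiber_ideals_sym. Qed.

Let sal : submod (al : R^o -> Prop) := submod_seq_ideal x n.
Let sall k : submod (@allin R k al) := submod_allin k sal.

(** A minimal family in a sum of copies of [I/(x)] is free over [R/J]: this ring
    is a discrete valuation ring with uniformizer [a], and [I/(x)] is
    torsion-free over it, so that a relation with coefficients in the maximal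
    ideal is [a] times a relation. *)
Lemma fiber_free I J a b k p (v : 'I_p -> 'rV[R]_k) : fiber_generators I J a b ->
  (forall i, allin I (v i)) ->
  (forall c : 'I_p -> R, allin al (\sum_i c i *: v i) -> forall i, m (c i)) ->
  forall c : 'I_p -> R, allin al (\sum_i c i *: v i) -> forall i, J (c i).
Proof.
move=> fg vI vmin c hc; have fIJ := fg_ideals fg.
have sI := fib_sI fIJ; have sJ := fib_sJ fIJ.
have [f hf] := row_map v.
pose W (u : 'rV[R]_p) := allin al (f u).
have sW : submod W.
  split; first by rewrite /W linear0; apply: (submod0 (sall _)).
  by move=> d u w hu hw; rewrite /W linearP; apply: (sall k).2.
have WJ : forall u, W u -> allin J u.
  apply: (nakayama sm m_proper m_unit (submod_allin p sJ)
    (fgen_mod_weaken (submod_allin p sJ) (fgen_submod nR sW (fun u _ => row_span u Logic.I)))).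
  move=> u hu.
  have /choice[t ht] : forall i, exists t, J (u 0 i - t * a).
    move=> i; have /(fib_m fIJ)[c' hi hj] : m (u 0 i).
      by apply: (vmin (fun i => u 0 i)); rewrite -hf.
    have [t ht] := fg_genI fg hi; exists t.
    have -> : u 0 i - t * a = (u 0 i - c') + (c' - t * a) by ring.
    by apply: (submodD sJ) => //; apply: (fib_aJ fIJ).
  pose w : 'rV[R]_p := \row_i t i.
  have hw : W w.
    have JI : allin al (f (u - a *: w)).
      rewrite hf; apply: (allin_sum (P := J) (Q := I)) => //.
        by move=> c1 c2 h1 h2; apply: (fiber_mul fIJ).
      by move=> i; rewrite !mxE mulrC.
    have faw : allin al (a *: f w).
      have -> : a *: f w = f u - f (u - a *: w) by rewrite linearB linearZ /=; zmod.
      exact: (submodB (sall _)).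
    move=> l; apply: (fib_IJ fIJ); last first.
      by apply: (fg_annI fg); have := faw l; rewrite mxE mulrC.
    rewrite hf; apply: (allin_sum (P := fun _ => True) (Q := I)) => //.
    by move=> c1 c2 _; apply: (submodZ _ sI).
  exists (u - a *: w); first by move=> i; rewrite !mxE mulrC; apply: ht.
  rewrite opprB addrC subrK; apply: prodS1 => //; exact: (fiber_mI fIJ (fg_a fg)).
move=> i; have := WJ (\row_i c i); rewrite /W hf => /(_ _ i); rewrite mxE; apply.
by under eq_bigr do rewrite mxE.
Qed.

(** The part of the next syzygy, modulo [(x)], with entries in [I]. *)
Lemma syzygy_component I J a b k l (B : 'M[R]_(k, l)) :
  fiber_generators I J a b -> tor_ok n B ->
  exists p (v : 'I_p -> 'rV[R]_k), [/\ forall i, v i *m B = 0, forall i, allin I (v i),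
    forall u, allin al (u *m B) -> allin I u ->
      exists c : 'I_p -> R, allin al (u - \sum_i c i *: v i) &
    forall c : 'I_p -> R, allin al (\sum_i c i *: v i) -> forall i, J (c i)].
Proof.
move=> fg tB; have fIJ := fg_ideals fg; have sI := fib_sI fIJ.
pose K (u : 'rV[R]_k) := allin al (u *m B) /\ allin I u.
have sK : submod K.
  split; first by split; [rewrite mul0mx; apply: (submod0 (sall _)) | apply: (submod0 (submod_allin k sI))].
  move=> c u v [h1 h2] [h3 h4]; split; last exact: (submod_allin k sI).2.
  by rewrite mulmxDl -scalemxAl; apply: (sall l).2.
have [p [v [vK gen vmin]]] := minimal_generators m_unit (sall k)
  (fgen_mod_weaken (sall k) (fgen_submod nR sK (fun u _ => row_span u Logic.I))).
have /choice[w hw] : forall i, exists w, w *m B = 0 /\ allin al (v i - w).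
  by move=> i; have [w ? ?] := tB _ (vK i).1; exists w.
have vw (c : 'I_p -> R) : allin al (\sum_i c i *: v i - \sum_i c i *: w i).
  rewrite -sumrB; apply: (submod_sum (sall _)) => // i; rewrite -scalerBr.
  by apply: (submodZ _ (sall _)) => //; case: (hw i).
have wI i : allin I (w i).
  have -> : w i = v i - (v i - w i) by zmod.
  apply: (submodB (submod_allin k sI)); first exact: (vK i).2.
  by move=> j; apply: (fib_aI fIJ); apply: (hw i).2.
exists p, w; split=> //; first by move=> i; case: (hw i).
  move=> u h1 h2; have [|_ [c ->] h] := gen u; first by [].
  exists c.
  have -> : u - \sum_i c i *: w i = (u - \sum_i c i *: v i)
    + (\sum_i c i *: v i - \sum_i c i *: w i) by zmod.
  exact: (submodD (sall _)).
apply: (fiber_free fg wI) => c h; apply: vmin.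
have -> : \sum_i c i *: v i = (\sum_i c i *: v i - \sum_i c i *: w i) + \sum_i c i *: w i by zmod.
exact: (submodD (sall _)).
Qed.

Variables (I J : R -> Prop) (a b : R).
Hypothesis fg : fiber_generators I J a b.
Let fIJ := fg_ideals fg.
Let sI := fib_sI fIJ.
Let sJ := fib_sJ fIJ.

(** The kernel of [B] modulo [(x)] is a direct sum of copies of [J/(x)] and
    [I/(x)]; the flag [e] exchanges the two. *)
Definition adapted (p : nat) (e : bool) k l (B : 'M[R]_(k, l)) : Prop :=
  forall u : 'rV[R]_k, allin al (u *m B) <->
    forall i : 'I_k, (if (i < p)%N (+) e then J else I) (u 0 i).

(** [B] is congruent modulo [(x)] to the diagonal matrix with the entries [b]
    and [a]. *)
Definition diagonal (p : nat) (e : bool) k l (B : 'M[R]_(k, l)) : Prop :=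
  forall (i : 'I_k) (j : 'I_l),
    al (B i j - (if i == j :> nat then (if (i < p)%N (+) e then b else a) else 0)).

Lemma adapted_minker p e k l (B : 'M[R]_(k, l)) : adapted p e B -> minker B.
Proof.
move=> aB u uB i; have /aB/(_ i) : allin al (u *m B).
  by rewrite uB; apply: (submod0 (sall _)).
by case: ifP => _; [apply: (fiber_mJ fIJ) | apply: (fiber_mI fIJ)].
Qed.

(** [tor_ok] for all the initial parts of the sequence. *)
Definition tor_all k l (B : 'M[R]_(k, l)) := forall i, (i <= n)%N -> tor_ok i B.

(** A minimal syzygy decomposes modulo [(x)]. *)
Lemma adapted_cover k l (B : 'M[R]_(k, l)) : tor_all B -> minker B ->
  exists q (B' : 'M[R]_(q, k)) p, exact_at B' B /\ adapted p false B'.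
Proof.
move=> tB mB; have tB' i : (i < n)%N -> tor_ok i B by move=> h; apply: tB; apply: ltnW.
have [p [v [vB vI genv vrel]]] := syzygy_component fg (tB n (leqnn n)).
have [q [w [wB wJ genw wrel]]] := syzygy_component (fiber_generators_sym fg) (tB n (leqnn n)).
pose B' : 'M[R]_(p + q, k) := col_mx (\matrix_i v i) (\matrix_i w i).
have B'E (u : 'rV[R]_(p + q)) :
    u *m B' = \sum_i u 0 (lshift q i) *: v i + \sum_i u 0 (rshift p i) *: w i.
  rewrite -[u in LHS]hsubmxK mul_row_col !mul_rows.
  by congr (_ + _); apply: eq_bigr => i _; rewrite mxE.
have im_ker (u : 'rV[R]_k) : (exists w, u = w *m B') -> u *m B = 0.
  move=> [u' ->]; rewrite B'E mulmxDl !mulmx_suml !big1 ?addr0 // => i _;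
    by rewrite -scalemxAl ?vB ?wB scaler0.
exists (p + q)%N, B', p; split.
  move=> u; split; last exact: im_ker.
  move: u; apply: (nakayama sm m_proper m_unit (submod_imM B')
    (fgen_mod_weaken (submod_imM B') (fgen_submod nR (submod_kerM B) (fun u _ => row_span u Logic.I)))).
  move=> u uB.
  have [uI hI hJ] := allin_split (fun c => (fib_m fIJ c).1) (mB u uB).
  have hIB : allin al (uI *m B).
    move=> i; apply: (fib_IJ fIJ); first exact: (allin_mul _ sI).
    have -> : uI *m B = - ((u - uI) *m B) by rewrite mulmxBl uB sub0r opprK.
    by rewrite mxE; apply: (submodN sJ); apply: (allin_mul _ sJ).
  have hJB : allin al ((u - uI) *m B).
    by rewrite mulmxBl uB sub0r; apply: (submodN (sall _)).
  have [c hc] := genv _ hIB hI; have [c' hc'] := genw _ hJB hJ.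
  pose u' : 'rV[R]_(p + q) := row_mx (\row_i c i) (\row_i c' i).
  have u'E : u' *m B' = \sum_i c i *: v i + \sum_i c' i *: w i.
    rewrite B'E; congr (_ + _); apply: eq_bigr => i _.
      by rewrite row_mxEl mxE.
    by rewrite row_mxEr mxE.
  exists (u' *m B'); first by exists u'.
  apply: tor_ok_ker => //.
    by rewrite mulmxBl uB [X in _ - X]im_ker ?subrr //; exists u'.
  rewrite u'E.
  have -> : u - (\sum_i c i *: v i + \sum_i c' i *: w i)
    = (uI - \sum_i c i *: v i) + (u - uI - \sum_i c' i *: w i) by zmod.
  exact: (submodD (sall _)).
have ltl (i : 'I_p) : (lshift q i < p)%N by apply: (ltn_ord i).
have ltr (i : 'I_q) : (rshift p i < p)%N = false by rewrite ltnNge leq_addr.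
move=> u; rewrite B'E; split=> [h i|h].
  have hv : allin I (\sum_i u 0 (lshift q i) *: v i).
    apply: (allin_sum (P := fun _ => True) (Q := I)) => //.
    by move=> c1 c2 _; apply: (submodZ _ sI).
  have hw : allin J (\sum_i u 0 (rshift p i) *: w i).
    apply: (allin_sum (P := fun _ => True) (Q := J)) => //.
    by move=> c1 c2 _; apply: (submodZ _ sJ).
  have hv' : allin al (\sum_i u 0 (lshift q i) *: v i).
    move=> j; apply: (fib_IJ fIJ); first exact: hv.
    have := h j; rewrite mxE => /(fib_aJ fIJ) h'.
    by rewrite -[X in J X](addrK ((\sum_i u 0 (rshift p i) *: w i) 0 j)); apply: (submodB sJ).
  have hw' : allin al (\sum_i u 0 (rshift p i) *: w i).
    move=> j; rewrite -[X in al X](addKr ((\sum_i u 0 (lshift q i) *: v i) 0 j)).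
    apply: (submodD sal); first by apply: (submodN sal); apply: hv'.
    by have := h j; rewrite mxE.
  rewrite addbF; case: (split_ordP i) => j ->.
    exact: (vrel (fun i => u 0 (lshift q i))).
  exact: (wrel (fun i => u 0 (rshift p i))).
apply: (submodD (sall _)) => //.
  apply: (allin_sum (P := J) (Q := I)) => // [c1 c2 h1 h2|i]; first exact: (fiber_mul fIJ).
  by have := h (lshift q i); rewrite addbF ltl.
apply: (allin_sum (P := I) (Q := J)) => // [c1 c2 h1 h2|i].
  by rewrite mulrC; apply: (fiber_mul fIJ).
by have := h (rshift p i); rewrite addbF ltr.
Qed.

Lemma diagonal_adapted p e k (B : 'M[R]_k) : diagonal p e B -> adapted p (~~ e) B.
Proof.
move=> dB u; pose g (i : 'I_k) := if (i < p)%N (+) e then b else a.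
have hB j : al ((u *m B) 0 j - u 0 j * g j).
  have -> : (u *m B) 0 j - u 0 j * g j
      = \sum_i u 0 i * (B i j - (if i == j :> nat then g i else 0)).
    under eq_bigr do rewrite mulrBr; rewrite sumrB mxE; congr (_ - _).
    rewrite (bigD1 j) //= eqxx big1 ?addr0 // => i ij.
    by rewrite ifN ?mulr0.
  by apply: (submod_sum sal) => i; apply: (submodZ _ sal).
have ann (i : 'I_k) c : al (c * g i) <-> (if (i < p)%N (+) ~~ e then J else I) c.
  rewrite /g addbN; case: (_ (+) _) => /=; split.
  - exact: fg_annJ fg _.
  - by move=> hc; rewrite mulrC; apply: (fiber_mul fIJ) => //; apply: fg_b fg.
  - exact: fg_annI fg _.
  - by move=> hc; apply: (fiber_mul fIJ) => //; apply: fg_a fg.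
split=> h i.
  apply/ann.
  have -> : u 0 i * g i = (u *m B) 0 i - ((u *m B) 0 i - u 0 i * g i) by ring.
  exact: (submodB sal).
rewrite -(subrK (u 0 i * g i) ((u *m B) 0 i)); apply: (submodD sal) => //.
exact: ((ann i (u 0 i)).2 (h i)).
Qed.

(** Once decomposed, the syzygies are periodic modulo [(x)]. *)
Lemma diagonal_cover p e k l (B : 'M[R]_(k, l)) : tor_all B -> adapted p e B ->
  exists B' : 'M[R]_k, exact_at B' B /\ diagonal p e B'.
Proof.
move=> tB aB; have tB' i : (i < n)%N -> tor_ok i B by move=> h; apply: tB; apply: ltnW.
pose g (i : 'I_k) := if (i < p)%N (+) e then b else a.
pose P (i : 'I_k) := if (i < p)%N (+) e then J else I.
have sP i : submod (P i : R^o -> Prop) by rewrite /P; case: ifP.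
have /choice[v hv] : forall i : 'I_k, exists v,
    v *m B = 0 /\ allin al (g i *: (delta_mx 0 i : 'rV[R]_k) - v).
  move=> i; have [|v ? ?] := tB n (leqnn n) (g i *: delta_mx 0 i); last by exists v.
  apply/aB => j; rewrite -/(P j) !mxE eqxx /=; case: eqP => [->|_]; last first.
    by rewrite mulr0; apply: (submod0 (sP j)).
  by rewrite mulr1 /g /P; case: ifP => _; [apply: fg_b fg | apply: fg_a fg].
pose B' : 'M[R]_k := \matrix_i v i.
have im_ker (u : 'rV[R]_k) : (exists w, u = w *m B') -> u *m B = 0.
  move=> [w ->]; rewrite mul_rows mulmx_suml big1 // => i _.
  by rewrite -scalemxAl (hv i).1 scaler0.
exists B'; split.
  move=> u; split; last exact: im_ker.
  move: u; apply: (nakayama sm m_proper m_unit (submod_imM B')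
    (fgen_mod_weaken (submod_imM B') (fgen_submod nR (submod_kerM B) (fun u _ => row_span u Logic.I)))).
  move=> u uB; have /aB hu : allin al (u *m B) by rewrite uB; apply: (submod0 (sall _)).
  have /choice[t ht] : forall i, exists t, al (u 0 i - t * g i).
    move=> i; have := hu i; rewrite /g.
    by case: ifP => _; [apply: fg_genJ fg _ | apply: fg_genI fg _].
  exists ((\row_i t i) *m B'); first by exists (\row_i t i).
  apply: tor_ok_ker => //.
    by rewrite mulmxBl uB [X in _ - X]im_ker ?subrr //; exists (\row_i t i).
  have -> : u - (\row_i t i) *m B' = \sum_i (u 0 i - t i * g i) *: delta_mx 0 i
      + \sum_i t i *: (g i *: delta_mx 0 i - v i).
    rewrite mul_rows [u in LHS]row_sum_delta -big_split /= -sumrB; apply: eq_bigr => i _.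
    by rewrite mxE scalerBl scalerBr scalerA; zmod.
  apply: (submodD (sall _)) => //; last first.
    by apply: (submod_sum (sall _)) => // i; apply: (submodZ _ (sall _)) => //; case: (hv i).
  apply: (allin_sum (P := al) (Q := fun _ => True)) => //.
  by move=> c1 c2 h1 _; rewrite mulrC; apply: (submodZ _ sal).
move=> i j; have := (hv i).2 j; rewrite !mxE eqxx /= => /(submodN sal) /=.
rewrite opprB -/(g i) eq_sym -val_eqE /=.
by case: eqP => _; rewrite ?mulr1 ?mulr0.
Qed.

End Syzygies.

(** * Free resolutions that become periodic modulo the regular sequence *)

Section Resolution.
Variables (R : comNzRingType) (m : R -> Prop).
Hypothesis sm : submod (m : R^o -> Prop).
Hypothesis m_proper : ~ m 1.
Hypothesis m_unit : forall c, ~ m c -> exists d, d * c = 1.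
Hypothesis nR : ideals_fgen R.
Variables (x : nat -> R) (n : nat).
Hypothesis regx : forall l, (l < n)%N -> forall c, seq_ideal x l (x l * c) -> seq_ideal x l c.
Hypothesis al_m : forall c, seq_ideal x n c -> m c.
Variables (I J : R -> Prop) (a b : R).
Hypothesis fg : fiber_generators m x n I J a b.

(** A map of a resolution, with the data [p] and [e] for which its kernel is
    [adapted] once it decomposes (and without meaning before that). *)
Record syzygy := Syzygy
  { syz_tgt : nat; syz_src : nat; syz_mx : 'M[R]_(syz_src, syz_tgt);
    syz_p : nat; syz_e : bool }.

(** The source and the matrix of the next map, with its own [p] and [e]. *)
Record cover (k : nat) := Cover
  { cov_src : nat; cov_mx : 'M[R]_(cov_src, k); cov_p : nat; cov_e : bool }.

(** What is required of the next map: it is minimal; its kernel decomposes as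
    soon as that is possible; and the rank stays constant from then on. *)
Definition next_spec (s : syzygy) (t : cover (syz_src s)) : Prop :=
  [/\ exact_at (cov_mx t) (syz_mx s), minker m (cov_mx t),
      tor_all x n (syz_mx s) -> minker m (syz_mx s) ->
        adapted x n I J (cov_p t) (cov_e t) (cov_mx t) &
      tor_all x n (syz_mx s) -> adapted x n I J (syz_p s) (syz_e s) (syz_mx s) ->
        [/\ cov_src t = syz_src s, cov_p t = syz_p s, cov_e t = ~~ syz_e s &
            diagonal x n a b (syz_p s) (syz_e s) (cov_mx t)]].

Lemma next_exists s : exists t, @next_spec s t.
Proof.
case: s => k l B p e; rewrite /next_spec /=.
have [q0 [B0 [ex0 min0]]] := minimal_cover m_unit nR (mulmxr B).
case: (pselect (tor_all x n B)) => [tB|ntB]; last by exists (Cover B0 0%N false).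
case: (pselect (adapted x n I J p e B)) => [aB|naB].
  have [B' [exB' dB']] := diagonal_cover sm m_proper m_unit nR regx al_m fg tB aB.
  have aB' := diagonal_adapted fg dB'.
  by exists (Cover B' p (~~ e)); split=> //; apply: (adapted_minker fg aB').
case: (pselect (minker m B)) => [mB|nmB]; last by exists (Cover B0 0%N false).
have [q [B' [p' [exB' aB']]]] := adapted_cover sm m_proper m_unit nR regx al_m fg tB mB.
by exists (Cover B' p' false); split=> //; apply: (adapted_minker fg aB').
Qed.

Definition next s := sval (cid (next_exists s)).

(** The target of the new map is, by conversion, the source of the old one, so
    that iterating [step] gives composable matrices. *)
Definition step s : syzygy :=
  @Syzygy (syz_src s) (cov_src (next s)) (cov_mx (next s)) (cov_p (next s)) (cov_e (next s)).

(** A free resolution of [M] whose differentials with index n + 2 or more are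
    diagonal modulo [(x)], with alternating entries. *)
Lemma periodic_resolution (M : lmodType R) : finitely_generated M ->
  exists (r : nat -> nat) (eps : {linear 'rV[R]_(r 0%N) -> M})
         (B : forall j, 'M[R]_(r j.+1, r j)),
  [/\ forall y, exists u, eps u = y,
      forall u, eps u = 0 <-> exists w, u = w *m B 0%N,
      forall j, exact_at (B j.+1) (B j),
      forall l j, (l <= n)%N -> (l <= j)%N -> tor_ok x l (B j) &
      exists p (e : nat -> bool), forall i,
        [/\ r (n.+2 + i)%N = r n.+2, e i.+1 = ~~ e i &
            diagonal x n a b p (e i) (B (n.+2 + i)%N)]].
Proof.
move=> [g hg]; have [eps heps] := row_map (fun i : 'I_(size g) => g`_i).
have [q0 [B0 [ex0 min0]]] := minimal_cover m_unit nR eps.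
pose s j := iter j step (@Syzygy (size g) q0 B0 0%N false).
exists (fun j => syz_tgt (s j)), eps, (fun j => syz_mx (s j)).
have spec j : next_spec (next (s j)) by apply: (svalP (cid (next_exists (s j)))).
have ex j : exact_at (syz_mx (s j.+1)) (syz_mx (s j)) by case: (spec j).
have mink j : minker m (syz_mx (s j)) by case: j => [//|j]; case: (spec j).
have tor l j : (l <= n)%N -> (l <= j)%N -> tor_ok x l (syz_mx (s j)).
  elim: l j => [|l ih] j ln lj; first exact: tor_ok0.
  case: j lj => // j lj; apply: (tor_okS regx ln (ex j)); apply: ih => //; exact: ltnW.
have tora j : (n <= j)%N -> tor_all x n (syz_mx (s j)).
  by move=> nj i ni; apply: tor => //; apply: leq_trans nj.
have ada j : (n < j)%N -> adapted x n I J (syz_p (s j)) (syz_e (s j)) (syz_mx (s j)).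
  by case: j => // j nj; case: (spec j) => _ _ h _; apply: h => //; apply: tora.
have per j : (n < j)%N -> [/\ syz_tgt (s j.+2) = syz_tgt (s j.+1), syz_p (s j.+1) = syz_p (s j),
    syz_e (s j.+1) = ~~ syz_e (s j) &
    diagonal x n a b (syz_p (s j)) (syz_e (s j)) (syz_mx (s j.+1))].
  by move=> nj; case: (spec j) => _ _ _; apply; [apply: tora; apply: ltnW | apply: ada].
split=> //.
- move=> y; have [c ->] := hg y; exists (\row_i c i); rewrite heps.
  by apply: eq_bigr => i _; rewrite mxE.
have pE i : syz_p (s (n.+1 + i)%N) = syz_p (s n.+1).
  elim: i => [|i ih]; first by rewrite addn0.
  by rewrite addnS -ih; have [|_ -> _ _] := per (n.+1 + i)%N; rewrite // ltnS leq_addr.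
exists (syz_p (s n.+1)), (fun i => syz_e (s (n.+1 + i)%N)) => i.
have [|_ _ he hd] := per (n.+1 + i)%N; first by rewrite ltnS leq_addr.
split; last by move: hd; rewrite pE.
- elim: i {he hd} => [|i ih]; first by rewrite addn0.
  rewrite addnS -[RHS]ih; have [|-> _ _ _] := per (n.+1 + i)%N; by rewrite // ltnS leq_addr.
- by rewrite addnS.
Qed.

End Resolution.

(** * Self-extensions *)

Section Complex.
Variables (R : comNzRingType) (M : lmodType R).
Variables (r : nat -> nat) (eps : {linear 'rV[R]_(r 0%N) -> M}) (B : forall j, 'M[R]_(r j.+1, r j)).
Hypothesis eps_surj : forall y, exists u, eps u = y.
Hypothesis eps_exact : forall u, eps u = 0 <-> exists w, u = w *m B 0%N.
Hypothesis B_exact : forall j, exact_at (B j.+1) (B j).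

Lemma differential_comp j : B j.+1 *m B j = 0.
Proof.
apply/row_matrixP => i; rewrite row0 rowE mulmxA.
by apply/(@B_exact j _); exists (delta_mx 0 i).
Qed.

Lemma row_projective k : projective_module ('rV[R]_k : lmodType R).
Proof.
move=> A A' f g hf; have /choice[s hs] : forall i, exists y, f y = g (delta_mx 0 i).
  by move=> i; apply: hf.
have [h hh] := row_map s; exists h => u.
by rewrite hh linear_sum [RHS]row_mapE; apply: eq_bigr => i _; rewrite linearZ hs.
Qed.

(** The matrices [B j] make up a projective resolution of [M], in which the
    vanishing of Ext is the extension of cocycles. *)
Lemma free_resolution : exists P : projective_resolution M,
  (forall j, r j = 0%N -> forall z : P j, z = 0) /\
  forall j, Ext_eq0 j.+1 M M -> forall f : {linear 'rV[R]_(r j.+1) -> M},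
    (forall z, f (z *m B j.+1) = 0) ->
    exists g : {linear 'rV[R]_(r j) -> M}, forall z, f z = g (z *m B j).
Proof.
have e0 (z : 'rV[R]_(r 0%N)) : eps z = 0 <-> exists w, mulmxr (B 0%N) w = z.
  by split=> [/eps_exact[w ->]|[w <-]]; [exists w | apply/eps_exact; exists w].
have eS i (z : 'rV[R]_(r i.+1)) : mulmxr (B i) z = 0 <-> exists w, mulmxr (B i.+1) w = z.
  by split=> [/(@B_exact i _)[w ->]|[w <-]]; [exists w | apply/(@B_exact i _); exists w].
pose P := @ProjectiveResolution R M (fun j => 'rV[R]_(r j)) (fun j => mulmxr (B j)) eps
  (fun j => @row_projective (r j)) eps_surj e0 eS.
exists P; split; last by move=> j hj f hf; exact: (hj P f hf).
by move=> j rj z; apply/rowP => i; have := ltn_ord i; rewrite [X in (_ < X)%N]rj.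
Qed.

Lemma mul_exact j c (C : 'M[R]_(c, r j.+1)) : C *m B j = 0 -> exists W, C = W *m B j.+1.
Proof.
move=> h; have /choice[w hw] : forall i, exists w, row i C = w *m B j.+1.
  by move=> i; apply/(@B_exact j _); rewrite -row_mul h row0.
by exists (\matrix_i w i); apply/row_matrixP => i; rewrite row_mul rowK.
Qed.

Lemma eps_mul_exact c (C : 'M[R]_(c, r 0%N)) : (forall u, eps (u *m C) = 0) ->
  exists W, C = W *m B 0%N.
Proof.
move=> h; have /choice[w hw] : forall i, exists w, row i C = w *m B 0%N.
  by move=> i; apply/eps_exact; rewrite rowE.
by exists (\matrix_i w i); apply/row_matrixP => i; rewrite row_mul rowK.
Qed.

Lemma eps_lift c (h : {linear 'rV[R]_c -> M}) :
  exists C : 'M[R]_(c, r 0%N), forall u, h u = eps (u *m C).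
Proof.
have /choice[w hw] : forall i, exists w, eps w = h (delta_mx 0 i) by move=> i; apply: eps_surj.
exists (\matrix_i w i) => u; rewrite mul_rows linear_sum [LHS]row_mapE.
by apply: eq_bigr => i _; rewrite linearZ hw.
Qed.

Section Extension.
Variables (E : injective_resolution (R^o : lmodType R)) (s : nat).
Hypothesis vanish : forall j, (s <= j)%N -> ext_vanish E j (fun u => eps u = 0) (fun=> True).

(** Vanishing for [M] in degrees above [s] is vanishing for the cokernel of
    [B i] in degrees above [s - i]. *)
Lemma syzygy_vanish i j : (s <= j + i)%N ->
  ext_vanish E j (fun u : 'rV[R]_(r i) => exists w, u = w *m B i) (fun=> True).
Proof.
elim: i j => [|i ih] j sij.
  have -> : (fun u : 'rV[R]_(r 0%N) => exists w, u = w *m B 0%N) = (fun u => eps u = 0).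
    by apply/funext => u; apply/propext; apply: iff_sym.
  by apply: vanish; rewrite addn0 in sij.
have -> : (fun u : 'rV[R]_(r i.+1) => exists w, u = w *m B i.+1) = (fun u => mulmxr (B i) u = 0).
  by apply/funext => u; apply/propext; apply: iff_sym; apply: B_exact.
apply: (@ext_vanish_transfer R E _ _ (mulmxr (B i)) j (fun u => u = 0)
  (fun u : 'rV[R]_(r i) => exists w, u = w *m B i)).
- exact: submod_zero.
- exact: submod_imM.
- by move=> u ->; exists 0; rewrite mul0mx.
- by move=> u; exists u.
- by move=> v [w ->]; exists w; rewrite /= subrr.
apply: (@ext_vanish_sub R E _ _ _ (fun=> True)) => //.
- by move=> u ->; exists 0; rewrite mul0mx.
- exact: ext_vanish_free.
- by apply: ih; rewrite addSnnS.
Qed.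

(** Since Ext^1 from the cokernel of [B i] to [R] vanishes, a map to a free
    module defined on the image of [B i] extends. *)
Lemma syzygy_extend i c (h : 'M[R]_(r i.+1, c)) : (s <= i)%N -> B i.+1 *m h = 0 ->
  exists h', h = B i *m h'.
Proof.
move=> si hB.
have aug_eq (y z : R) : ir_aug E y = ir_aug E z -> y = z by apply: (@ir_aug_inj _ _ E).
have col_ext l : exists f : 'I_(r i) -> R, forall w : 'rV[R]_(r i.+1),
    (w *m h) 0 l = \sum_k (w *m B i) 0 k * f k.
  pose V (u : 'rV[R]_(r i)) := exists w, u = w *m B i.
  have sV : submod V by apply: submod_imM.
  have /choice[t ht] : forall u, exists w, V u -> u = w *m B i.
    by move=> u; case: (pselect (V u)) => [[w hw]|hu]; [exists w | exists 0].
  have tE u w : V u -> u = w *m B i -> t u *m h = w *m h.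
    move=> hu hw; apply/eqP; rewrite -subr_eq0 -mulmxBl.
    have /(@B_exact i _)[v ->] : (t u - w) *m B i = 0 by rewrite mulmxBl -ht // -hw subrr.
    by rewrite -mulmxA hB mulmx0.
  have [|phi hphi] := @injective_extend R (E 0%N) _ V (fun u => ir_aug E ((t u *m h) 0 l))
      (@ir_injective _ _ E _) sV.
    move=> c' u v hu hv; rewrite (tE _ (c' *: t u + t v)).
    - by rewrite mulmxDl -scalemxAl !mxE -linearP.
    - exact: sV.2.
    - by rewrite mulmxDl -scalemxAl -!ht.
  have phiE w : phi (w *m B i) = ir_aug E ((w *m h) 0 l).
    have hV : V (w *m B i) by exists w.
    by rewrite hphi // (tE _ w).
  have [||psi [psiV hpsi]] := @syzygy_vanish i 0 si (ir_d E _ \o phi : {linear _ -> _}).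
  - by move=> u [w ->] /=; rewrite phiE; apply/ir_exact0; exists ((w *m h) 0 l).
  - by move=> u _ /=; apply: ir_dd.
  have /choice[f hf] : forall k, exists y, ir_aug E y = phi (delta_mx 0 k) - psi (delta_mx 0 k).
    by move=> k; apply/ir_exact0; rewrite linearB /= -hpsi //= subrr.
  exists f => w; apply: aug_eq; rewrite -phiE -[LHS]subr0 -(psiV (w *m B i)); last by exists w.
  rewrite [phi _]row_mapE [psi _]row_mapE -sumrB linear_sum; apply: eq_bigr => k _.
  by rewrite -scalerBr -hf -linearZ.
have /choice[f hf] := col_ext.
exists (\matrix_(k, l) f l k); apply/row_matrixP => k; apply/rowP => l.
rewrite row_mul [row k h]rowE hf -rowE [RHS]mxE; apply: eq_bigr => k' _.
by rewrite !mxE.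
Qed.

End Extension.

Section SelfExt.
Variables (n t : nat) (x : nat -> R).
Hypothesis nt : (n < t)%N.
Hypothesis regx : forall l, (l < n)%N -> forall c, seq_ideal x l (x l * c) -> seq_ideal x l c.
Hypothesis extend : forall i c (h : 'M[R]_(r i.+1, c)), (n < i)%N -> B i.+1 *m h = 0 ->
  exists h', h = B i *m h'.
Hypothesis ext_MM : forall j, (t <= j.+1 <= t + n)%N -> forall f : {linear 'rV[R]_(r j.+1) -> M},
  (forall z, f (z *m B j.+1) = 0) ->
  exists g : {linear 'rV[R]_(r j) -> M}, forall z, f z = g (z *m B j).

(** Ext^j(N, N) = 0 for the [s]-th syzygy [N] and j = k + 1 - s: by [extend], a
    cocycle is lifted step by step to a cocycle with values in [M], which is a
    coboundary, and the homotopy is carried back. *)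
Lemma syzygy_self_ext s k (h : 'M[R]_(r k.+1, r s)) : (s <= k)%N ->
  (t <= (k - s).+1 <= t + n)%N ->
  match s return 'M[R]_(r k.+1, r s) -> Prop with
  | 0 => fun h => forall u, eps (u *m (B k.+1 *m h)) = 0
  | s'.+1 => fun h => B k.+1 *m h *m B s' = 0
  end h ->
  exists u v, h = B k *m u + v *m B s.
Proof.
elim: s k h => [|s ih] k h sk tk hh.
  rewrite subn0 in tk.
  have [f hf] : exists f : {linear 'rV[R]_(r k.+1) -> M}, forall u, f u = eps (u *m h).
    by apply: linear_map_exists => c u v; rewrite mulmxDl -scalemxAl linearP.
  have [|g hg] := @ext_MM k tk f; first by move=> z; rewrite hf -mulmxA hh.
  have [u hu] := eps_lift g.
  have [|v hv] := @eps_mul_exact _ (h - B k *m u).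
    by move=> z; rewrite mulmxBr linearB /= -hf hg hu mulmxA subrr.
  by exists u, v; rewrite -hv addrC subrK.
case: k h sk tk hh => // k h sk tk hh; rewrite subSS in tk.
have [h' hh'] : exists h', h *m B s = B k.+1 *m h'.
  apply: extend; last by rewrite mulmxA.
  apply: (leq_trans nt); case/andP: tk => tk _; apply: (leq_trans tk).
  by rewrite ltnS leq_subr.
have [||u [v huv]] := ih k h' _ tk; first exact: sk.
  case: s {ih} h sk tk hh h' hh' => [|s] h sk tk hh h' hh'.
    move=> z; rewrite -hh'; apply/eps_exact; exists (z *m h).
    by rewrite mulmxA.
  by rewrite -hh' -mulmxA differential_comp mulmx0.
have [w hw] : exists w, h - B k.+1 *m v = w *m B s.+1.
  apply: mul_exact; rewrite mulmxBl hh' huv mulmxDr -!mulmxA.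
  by rewrite mulmxA differential_comp mul0mx add0r subrr.
by exists v, w; rewrite -hw addrC subrK.
Qed.

(** Matrices with all their entries in [P]. *)
Definition all_mx k l (P : R -> Prop) (C : 'M[R]_(k, l)) : Prop := forall i j, P (C i j).

Lemma all_mxD k l P (C C' : 'M[R]_(k, l)) : submod (P : R^o -> Prop) ->
  all_mx P C -> all_mx P C' -> all_mx P (C + C').
Proof. by move=> sP h h' i j; rewrite mxE; apply: (submodD sP). Qed.

Lemma all_mxM k l q P (C : 'M[R]_(k, l)) (C' : 'M[R]_(l, q)) : submod (P : R^o -> Prop) ->
  all_mx P C' -> all_mx P (C *m C').
Proof.
by move=> sP h i j; rewrite mxE; apply: (submod_sum sP) => k'; apply: (submodZ _ sP).
Qed.

Lemma all_mxMr k l q P (C : 'M[R]_(k, l)) (C' : 'M[R]_(l, q)) : submod (P : R^o -> Prop) ->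
  all_mx P C -> all_mx P (C *m C').
Proof.
move=> sP h i j; rewrite mxE; apply: (submod_sum sP) => k'.
by rewrite mulrC; apply: (submodZ _ sP).
Qed.

Lemma all_mxZ k l P c (C : 'M[R]_(k, l)) : submod (P : R^o -> Prop) ->
  all_mx P C -> all_mx P (c *: C).
Proof. by move=> sP h i j; rewrite mxE; apply: (submodZ _ sP). Qed.

Lemma all_mx_seqS k l (C : 'M[R]_(k, l)) p :
  all_mx (seq_ideal x p.+1) C -> exists C', all_mx (seq_ideal x p) (C - x p *: C').
Proof.
move=> h; have /choice[f hf] : forall i, exists f : 'I_l -> R, forall j,
    seq_ideal x p (C i j - f j * x p) 
    by move=> i; have /choice[f hf] : forall j, exists d, seq_ideal x p (C i j - d * x p) := h i; exists f.
by exists (\matrix_(i, j) f i j) => i j; rewrite !mxE mulrC.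
Qed.

Variable s : nat.
Hypothesis tor_s : forall l, (l <= n)%N -> tor_ok x l (B s).

(** [x_l] is a nonzerodivisor on N/(x_0,..,x_(l-1))N, where [N] is the cokernel of
    [B s.+1]. *)
Lemma syzygy_regular l c (C u : 'M[R]_(c, _)) (v : 'M[R]_(c, r s.+1)) : (l < n)%N ->
  all_mx (seq_ideal x l) v -> x l *: C = u *m B s.+1 + v ->
  exists u' v', C = u' *m B s.+1 + v' /\ all_mx (seq_ideal x l) v'.
Proof.
move=> ln hv hC; have sl := submod_seq_ideal x l.
have hB i : allin (seq_ideal x l) (row i C *m B s).
  move=> j; apply: (regx ln).
  have -> : x l * (row i C *m B s) 0 j = (v *m B s) i j.
    have -> : x l * (row i C *m B s) 0 j = (x l *: C *m B s) i j.
      by rewrite -row_mul -scalemxAl !mxE.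
    by rewrite hC mulmxDl -mulmxA differential_comp mulmx0 add0r.
  exact: all_mxMr.
have /choice[w hw] : forall i, exists w, allin (seq_ideal x l) (row i C - w *m B s.+1).
  by move=> i; have [_ /(@B_exact s _)[w ->] h] := tor_s (ltnW ln) (hB i); exists w.
exists (\matrix_i w i), (C - (\matrix_i w i) *m B s.+1); split; first by rewrite addrC subrK.
move=> i j; have := hw i j.
have -> : w i *m B s.+1 = row i ((\matrix_i w i) *m B s.+1) by rewrite row_mul rowK.
by rewrite !mxE.
Qed.

(** Ext^j(N, N/(x_0,..,x_(l-1))N) = 0 for the cokernel [N] of [B s.+1] and
    j = k - s, by induction on [l]: multiplication by [x_l] on the coefficients
    uses the vanishing in degrees j and j + 1. *)
Lemma syzygy_self_ext_mod l k (h : 'M[R]_(r k.+1, r s.+1)) (u : 'M[R]_(_, _)) v :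
  (l <= n)%N -> (s < k)%N -> (t <= (k - s.+1).+1)%N -> ((k - s.+1).+1 + l <= t + n)%N ->
  B k.+1 *m h = u *m B s.+1 + v -> all_mx (seq_ideal x l) v ->
  exists u' v' w, h = B k *m u' + v' *m B s.+1 + w /\ all_mx (seq_ideal x l) w.
Proof.
elim: l k h u v => [|l ih] k h u v ln sk t1 t2 hh hv.
  have v0 : v = 0 by apply/matrixP => i j; rewrite mxE; apply: hv.
  have [//|||u' [v' ->]] := @syzygy_self_ext s.+1 k h.
  - by rewrite t1; rewrite addn0 in t2.
  - by rewrite hh v0 addr0 -mulmxA differential_comp mulmx0.
  by exists u', v', 0; rewrite addr0; split=> // i j; rewrite mxE.
have sl := submod_seq_ideal x l.
have [w hw] := all_mx_seqS hv.
have hx : x l *: (B k.+2 *m w) = - (B k.+2 *m u) *m B s.+1 + - (B k.+2 *m (v - x l *: w)).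
  have /eqP : B k.+2 *m u *m B s.+1 + B k.+2 *m v = 0.
    by rewrite -mulmxA -mulmxDr -hh mulmxA differential_comp mul0mx.
  by rewrite addr_eq0 mulNmx mulmxBr -scalemxAr => /eqP ->; zmod.
have hneg : all_mx (seq_ideal x l) (- (B k.+2 *m (v - x l *: w))).
  by move=> i j; rewrite mxE; apply: (submodN sl); apply: (all_mxM _ sl).
have [u1 [v1 [e1 hv1]]] := syzygy_regular ln hneg hx.
have ek : (k.+1 - s.+1 = (k - s.+1).+1)%N by rewrite subSn.
have [||u2 [v2 [w2 [e2 hw2]]]] := ih k.+1 w u1 v1 (ltnW ln) (leqW sk) _ _ e1 hv1.
- by rewrite ek; apply: leqW.
- by rewrite ek addSnnS.
have e3 : B k.+1 *m (h - x l *: u2) = (u + x l *: v2) *m B s.+1 + (v - x l *: w + x l *: w2).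
  rewrite mulmxBr hh -scalemxAr mulmxDl -scalemxAl.
  have -> : B k.+1 *m u2 = w - v2 *m B s.+1 - w2 by rewrite [in w - _]e2; zmod.
  by rewrite !scalerBr; zmod.
have [||u3 [v3 [w3 [e4 hw3]]]] := ih k (h - x l *: u2) _ _ (ltnW ln) sk t1 _ e3.
- by apply: leq_trans t2; rewrite leq_add2l.
- by apply: (all_mxD sl) => //; apply: (all_mxZ _ sl).
exists u3, v3, (w3 + x l *: u2); split; first by rewrite addrA -e4 subrK.
move=> i j; exists (u2 i j); rewrite !mxE.
have -> : w3 i j + x l * u2 i j - u2 i j * x l = w3 i j by ring.
exact: hw3.
Qed.

End SelfExt.

End Complex.

(** * Local rings, regular sequences and fiber products *)

Section Interface.
Variable R : comNzRingType.

(** In a local ring, an ideal [m] whose quotient is a field is the maximal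
    ideal, so that every element outside it is invertible. *)
Lemma local_unit (m : R -> Prop) : local_ring R ->
  submod (m : R^o -> Prop) -> ~ m 1 -> (forall c, ~ m c -> exists d, m (1 - d * c)) ->
  forall c, ~ m c -> exists d, d * c = 1.
Proof.
move=> [/noetherian_fgen nR [m0 _ m0_uniq]] sm m1 mf.
pose toP (I : R -> Prop) : {pred R} := fun a => `[< I a >].
have toPE I c : c \in toP I <-> I c by split=> [/asboolP|h] //; apply/asboolP.
have toP_ideal I : submod (I : R^o -> Prop) -> ~ I 1 -> idealr_closed (toP I).
  move=> sI nI; split; first by apply/asboolP; apply: (submod0 sI).
    by apply/asboolP.
  by move=> a u v /asboolP hu /asboolP hv; apply/asboolP; apply: sI.2.
have of_ideal (I : {pred R}) : idealr_closed I -> submod ((fun c => c \in I) : R^o -> Prop).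
  by case=> h0 _ h; split=> // c u v hu hv; apply: h.
have maxm : maximal_ideal (toP m).
  split; first exact: toP_ideal.
  move=> I hI mI c; apply/idP/idP => [hc|]; last exact: mI.
  apply/toPE; apply: contrapT => /mf[d hd].
  have [_ nI1 _] := hI; move/negP: nI1; apply.
  have -> : 1 = (1 - d * c) + d * c by rewrite subrK.
  apply: (submodD (of_ideal _ hI)); first by apply: mI; apply/toPE.
  exact: (submodZ _ (of_ideal _ hI)).
have ex_max : forall I, submod (I : R^o -> Prop) -> ~ I 1 ->
    exists2 m' : {pred R}, maximal_ideal m' & forall c, I c -> c \in m'.
  apply: (ideal_ind nR) => I sI ih nI.
  case: (pselect (exists J : R -> Prop, [/\ submod (J : R^o -> Prop), forall c, I c -> J c,
    exists2 c, J c & ~ I c & ~ J 1])) => [[J [sJ IJ hJ nJ]]|hI].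
    by have [m' mm hm] := ih J sJ IJ hJ nJ; exists m' => // c /IJ; apply: hm.
  exists (toP I); last by move=> c hc; apply/toPE.
  split; first exact: toP_ideal.
  move=> J hJ IJ c; apply/idP/idP => [hc|]; last exact: IJ.
  apply/toPE; apply: contrapT => nc; apply: hI; exists (fun c => c \in J); split.
  - exact: of_ideal.
  - by move=> c' hc'; apply: IJ; apply/toPE.
  - by exists c.
  - by have [_ /negP] := hJ.
move=> c nmc; apply: contrapT => nu.
have sG : submod (fun u : R^o => exists d, u = d * c).
  split; first by exists 0; rewrite mul0r.
  by move=> a u v [d ->] [d' ->]; exists (a * d + d'); rewrite mulrDl -mulrA.
have [|m' mm hm] := ex_max _ sG; first by move=> [d hd]; apply: nu; exists d.
apply: nmc; apply/toPE; rewrite (m0_uniq _ maxm) -(m0_uniq _ mm); apply: hm.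
by exists 1; rewrite mul1r.
Qed.

Lemma ideal_genE (s : seq R) c :
  c \in ideal_gen s <-> exists f : nat -> R, c = \sum_(i < size s) f i * s`_i.
Proof.
split=> [/asboolP[f ->]|[f ->]]; last by apply/asboolP; exists (fun i => f i).
exists (fun i => oapp f 0 (insub i)); apply: eq_bigr => i _.
by rewrite valK.
Qed.

(** The two descriptions of the ideal generated by an initial part of [s]. *)
Lemma ideal_gen_seq (s : seq R) l c : (l <= size s)%N ->
  c \in ideal_gen (take l s) <-> seq_ideal (nth 0 s) l c.
Proof.
elim: l c => [|l ih] c ls.
  rewrite take0; split=> [/ideal_genE[f ->]|/= ->]; first by rewrite big_ord0.
  by apply/ideal_genE; exists (fun=> 0); rewrite big_ord0.
have stake : size (take l s) = l by rewrite size_takel // ltnW.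
have sumE (f : nat -> R) : \sum_(i < size (take l.+1 s)) f i * (take l.+1 s)`_i
    = \sum_(i < size (take l s)) f i * (take l s)`_i + f l * s`_l.
  rewrite (take_nth 0 ls) size_rcons big_ord_recr /= nth_rcons ltnn eqxx stake.
  by congr (_ + _); apply: eq_bigr => i _; rewrite nth_rcons stake ltn_ord.
split=> [/ideal_genE[f ->]|/= [d /(ih _ (ltnW ls))/ideal_genE[f hf]]].
  exists (f l); apply/(ih _ (ltnW ls))/ideal_genE; exists f.
  by rewrite sumE addrK.
pose h i := if (i < l)%N then f i else d; apply/ideal_genE; exists h.
rewrite sumE {2}/h ltnn -(subrK (d * s`_l) c) hf; congr (_ + _).
by apply: eq_bigr => i _; rewrite /h -[X in (_ < X)%N]stake ltn_ord.
Qed.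

Lemma quotient_map (I : idealr R) : exists p : {rmorphism R -> {ideal_quot I}},
  (forall y, exists c, p c = y) /\ forall c, p c = 0 <-> c \in I.
Proof.
pose p : {rmorphism R -> {ideal_quot I}} := \pi_({ideal_quot I})%qT.
have pE c : (c \in I) = (p c == p 0) by rewrite -[c in LHS]subr0 Quotient.idealrBE.
exists p; split; first by move=> y; exists (repr y); apply: reprK.
by move=> c; rewrite pE rmorph0; split=> /eqP.
Qed.

(** In a fiber product of [S] and [T], the ideals [I] and [J] are given by the
    pairs with second, respectively first, component zero. *)
Lemma fiber_ideals_exist (A : comNzRingType) (p : {rmorphism R -> A}) (x : nat -> R) n :
  (forall y, exists c, p c = y) -> (forall c, p c = 0 <-> seq_ideal x n c) ->
  fiber_product_ring A ->
  exists m I J : R -> Prop, [/\ submod (m : R^o -> Prop), ~ m 1,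
    forall c, ~ m c -> exists d, m (1 - d * c) & fiber_ideals m x n I J].
Proof.
move=> psurj pker [_ [S [T [k [piS [piT [_ [surjS surjT] [ninjS ninjT] [f [g fK gK]]]]]]]]].
pose F c : S * T := fiber_val (f (p c)).
have FD c c' : F (c + c') = F c + F c' by rewrite /F !rmorphD.
have FM c c' : F (c * c') = F c * F c' by rewrite /F !rmorphM.
have FN c : F (- c) = - F c by rewrite /F !rmorphN.
have F1 : F 1 = 1 by rewrite /F !rmorph1.
have F0 : F 0 = 0 by rewrite /F !rmorph0.
have Feq c : piS (F c).1 = piT (F c).2.
  by rewrite /F; case: (f (p c)) => u /= /eqP.
have Fsurj s t : piS s = piT t -> exists c, F c = (s, t).
  move=> e; have hst : (s, t) \in fiber_pred piS piT by rewrite unfold_in /=; apply/eqP.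
  have [c hc] := psurj (g (FiberProduct hst)); exists c.
  by rewrite /F hc gK.
have Fker c : F c = 0 <-> seq_ideal x n c.
  rewrite -pker; split=> [h|h]; last by rewrite /F h !rmorph0.
  apply: (can_inj fK); rewrite rmorph0; apply: val_inj; exact: h.
pose m c := piS (F c).1 = 0.
pose I c := (F c).2 = 0.
pose J c := (F c).1 = 0.
have IJ c : I c -> J c -> seq_ideal x n c.
  by move=> hI hJ; apply/Fker; rewrite [F c]surjective_pairing hI hJ.
have nonzero (U V : comNzRingType) (h : {rmorphism U -> V}) : ~ injective h ->
    exists2 s, h s = 0 & s <> 0.
  move=> nh; apply: contrapT => hs; apply: nh => u v e; apply/eqP.
  rewrite -subr_eq0; apply/eqP; apply: contrapT => uv; apply: hs.
  by exists (u - v) => //; rewrite rmorphB e subrr.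
exists m, I, J; split.
- split; first by rewrite /m F0 rmorph0.
  by move=> c u v hu hv; rewrite /m FD FM /= rmorphD rmorphM hu hv mulr0 addr0.
- by rewrite /m F1 /= rmorph1 => /eqP; rewrite oner_eq0.
- move=> c /eqP nc; have [s hs] := surjS (piS (F c).1)^-1.
  have [t ht] := surjT (piS (F c).1)^-1.
  have [|d hd] := Fsurj s t; first by rewrite hs ht.
  exists d; rewrite /m FD FN FM hd F1 /= rmorphD rmorphN rmorphM rmorph1 hs.
  by rewrite mulVf // subrr.
- split.
  + split; first by rewrite /I F0.
    by move=> c u v hu hv; rewrite /I FD FM /= hu hv mulr0 addr0.
  + split; first by rewrite /J F0.
    by move=> c u v hu hv; rewrite /J FD FM /= hu hv mulr0 addr0.
  + by move=> c /Fker hc; rewrite /I hc.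
  + by move=> c /Fker hc; rewrite /J hc.
  + exact: IJ.
  + move=> c; split=> [hc|[i hi hj]].
      have [|i hi] := Fsurj (F c).1 0; first by rewrite rmorph0.
      exists i; first by rewrite /I hi.
      by rewrite /J FD FN hi /= subrr.
    have -> : c = i + (c - i) by rewrite addrC subrK.
    rewrite /m FD /= rmorphD hj rmorph0 addr0 Feq hi; exact: rmorph0.
  + have [s hs ns] := nonzero _ _ _ ninjS.
    have [|c hc] := Fsurj s 0; first by rewrite hs rmorph0.
    by exists c; rewrite ?/I ?hc // => /Fker; rewrite hc => -[/ns].
  + have [t ht nt] := nonzero _ _ _ ninjT.
    have [|c hc] := Fsurj 0 t; first by rewrite ht rmorph0.
    by exists c; rewrite ?/J ?hc // => /Fker; rewrite hc => -[/nt].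
Qed.

End Interface.

(** * Periodicity against the vanishing of self-extensions *)

(** The identity matrix, between free modules whose ranks are equal but not
    convertible. *)
Lemma mul_identity_mx (R : comNzRingType) c k l (e : l = k) (C : 'M[R]_(c, k)) i (j : 'I_l) :
  (C *m \matrix_(i < k, j < l) (i == j :> nat)%:R) i j = C i (cast_ord e j).
Proof.
subst k; rewrite cast_ord_id mxE (bigD1 j) //= mxE eqxx mulr1 big1 ?addr0 // => i' /negbTE ne.
by rewrite mxE val_eqE ne mulr0.
Qed.

Lemma identity_mul_mx (R : comNzRingType) c k l (e : k = l) (C : 'M[R]_(l, c)) (i : 'I_k) j :
  ((\matrix_(i < k, j < l) (i == j :> nat)%:R) *m C) i j = C (cast_ord e i) j.
Proof.
subst l; rewrite cast_ord_id mxE (bigD1 i) //= mxE eqxx mul1r big1 ?addr0 // => i' /negbTE ne.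
by rewrite mxE val_eqE eq_sym ne mul0r.
Qed.

Theorem proposition3p30 (R : comNzRingType) (n : nat) (x : n.-tuple R)
    (M : lmodType R) (t : nat)
    (hR : gorenstein R) (hx : quasi_fiber_product_ring x)
    (hM : finitely_generated M)
    (ht_even : ~~ odd t) (ht : (n < t)%N)
    (hExt : forall i : nat, (t <= i <= t + n)%N -> Ext_eq0 i M M) :
  finite_projdim M.
Proof.
have [lR [D [E E_bound]]] := hR; have nR := noetherian_fgen lR.1.
have [_ [regx0 _] [I0 I0E fib]] := hx.
pose y := nth 0 x.
have genE l c : (l <= n)%N -> c \in ideal_gen (take l x) <-> seq_ideal y l c.
  by move=> ln; apply: ideal_gen_seq; rewrite size_tuple.
have regx l : (l < n)%N -> forall c, seq_ideal y l (y l * c) -> seq_ideal y l c.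
  move=> ln c /genE h; apply/genE; first exact: ltnW.
  by apply: regx0; [rewrite size_tuple | apply: h; apply: ltnW].
have [p [psurj pker]] := quotient_map I0.
have {}pker c : p c = 0 <-> seq_ideal y n c.
  by rewrite pker I0E -genE // take_oversize ?size_tuple.
have [m [I [J [sm m1 mf fIJ]]]] := fiber_ideals_exist psurj pker fib.
have m_unit := local_unit lR sm m1 mf.
have al_m c : seq_ideal y n c -> m c by move=> /(fib_aI fIJ); apply: (fiber_mI fIJ).
have vI := fiber_vanish m_unit nR regx E_bound fIJ (leqnn n).
have vJ := fiber_vanish m_unit nR regx E_bound (fiber_ideals_sym fIJ) (leqnn n).
have [a [Ia genI annI]] := fiber_principal sm m1 m_unit nR regx fIJ vI.
have [b [Jb genJ annJ]] := fiber_principal sm m1 m_unit nR regx (fiber_ideals_sym fIJ) vJ.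
have fg : fiber_generators m y n I J a b by split.
have vk := residue_vanish sm m_unit nR regx E_bound fIJ.
have [r [eps [B [eps_surj eps_ex B_ex torB [q [e perB]]]]]] :=
  periodic_resolution sm m1 m_unit nR regx al_m fg hM.
have vanish j : (n < j)%N -> ext_vanish E j (fun u => eps u = 0) (fun=> True).
  move=> nj; apply: (ext_vanish_bound sm m1 m_unit nR E_bound vk nj (submod_ker eps)).
  by move=> u; apply: row_span.
have extend i c (h : 'M[R]_(r i.+1, c)) := @syzygy_extend R M r eps B eps_ex B_ex E n.+1 vanish i c h.
have [P [P0 extP]] := free_resolution eps_surj eps_ex B_ex.
have rE i : r (n.+2 + i)%N = r n.+2 by case: (perB i).
have eE i : e i = e 0%N (+) odd i.
  by elim: i => [|i ih]; [rewrite addbF | case: (perB i) => _ -> _; rewrite ih /= addbN].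
have dB i : diagonal y n a b q (e i) (B (n.+2 + i)%N) by case: (perB i).
have Bm i : all_mx m (B (n.+2 + i)%N).
  move=> k l; rewrite -[B _ k l](subrK (if k == l :> nat then
    (if (k < q)%N (+) e i then b else a) else 0)).
  apply: (maxD sm); first by apply: al_m; apply: dB.
  case: eqP => _; last exact: (submod0 sm).
  by case: ifP => _; [apply: (fiber_mJ fIJ) | apply: (fiber_mI fIJ)].
case: (posnP (r n.+2)) => [r0|r_gt0].
  exists n.+1, P => i /subnKC ni z; apply: P0.
  by rewrite -ni rE.
exfalso; apply: m1.
case: t ht ht_even hExt => // t ht ht_even hExt.
pose k := (n.+2 + t)%N.
have kE : k.+1 = (n.+2 + t.+1)%N by rewrite addnS.
have rk : r k.+1 = r n.+2 by rewrite kE rE.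
have rk1 : r k.+2 = r n.+3.
  by have h1 := rE 1%N; have h2 := rE t.+2; rewrite addn1 in h1; rewrite h1 -h2 !addnS.
have torn l : (l <= n)%N -> tor_ok y l (B n.+1) by move=> ln; apply: torB => //; exact: ltnW.
(* By periodicity and the parity of t, the identity is a cocycle modulo (x). *)
pose h : 'M[R]_(r k.+1, r n.+2) := \matrix_(i, j) (i == j :> nat)%:R.
pose u : 'M[R]_(r k.+2, r n.+3) := \matrix_(i, j) (i == j :> nat)%:R.
have dk : diagonal y n a b q (e 0%N) (B k.+1).
  have -> : e 0%N = e t.+1 by rewrite [RHS]eE (negbTE ht_even) addbF.
  by rewrite kE; apply: dB.
have d0 : diagonal y n a b q (e 0%N) (B n.+2) by have := dB 0%N; rewrite addn0.
have hv : all_mx (seq_ideal y n) (B k.+1 *m h - u *m B n.+2).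
  move=> i j; rewrite mxE [X in _ + X]mxE.
  rewrite (mul_identity_mx (esym rk)) (identity_mul_mx rk1).
  have h1 := dk i (cast_ord (esym rk) j); have h2 := d0 (cast_ord rk1 i) j.
  have := submodB (submod_seq_ideal y n) h1 h2; rewrite /= => h3.
  by move: h3; congr (seq_ideal y n _); zmod.
have hh : B k.+1 *m h = u *m B n.+2 + (B k.+1 *m h - u *m B n.+2) by rewrite addrC subrK.
have ext_MM j (hj : (t.+1 <= j.+1 <= t.+1 + n)%N) := extP j (hExt j.+1 hj).
have kn : (k - n.+2)%N = t by rewrite addKn.
have [|||u' [v' [w [hE hw]]]] := syzygy_self_ext_mod eps_surj eps_ex B_ex ht regx extend ext_MM
  torn (leqnn n) _ _ _ hh hv.
- by rewrite /k ltnS leq_addr.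
- by rewrite kn.
- by rewrite kn.
(* As a coboundary, the identity matrix has all its entries in m. *)
pose j0 := Ordinal r_gt0; pose i0 := cast_ord (esym rk) j0.
have -> : 1 = h i0 j0 by rewrite mxE eqxx.
have sm' : submod (m : R^o -> Prop) := sm.
rewrite hE; apply: all_mxD => //; last by move=> i j; apply: al_m; apply: hw.
apply: all_mxD => //.
  by apply: all_mxMr => //; apply: Bm.
by apply: all_mxM => //; have := Bm 0%N; rewrite addn0.
Qed.
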